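(* Let $\Omega\subset\mathbb{C}$ be a domain, let $L=i+\sqrt{-1}\,j\in\mathbb{H}_{\mathbb{C}}$, and let $\Phi\colon\Omega\to\mathbb{H}_{\mathbb{C}}$ be a holomorphic function such that $\Phi_0\equiv\Phi^s\equiv 0$. Then there exists a meromorphic curve $\chi\colon\Omega\to\mathbb{H}_{\mathbb{C}}$ such that $$\Phi=\chi L\chi^{-1}.$$ All minimal surfaces in isothermal coordinates can be constructed from this formula $\Phi=\chi L\chi^{-1}$ by integration via $$X(u,v)=\mathbf{c}+\operatorname{Re}\Bigl(\int_{\gamma}\Phi(\omega)\,d\omega\Bigr),$$ where $\mathbf{c}\in\mathbb{R}^3$ is fixed and $\gamma$ is a simple curve from $z_0=u_0+\sqrt{-1}\,v_0$ to $z=u+\sqrt{-1}\,v$ in a simply connected component of the domain of $\Phi$.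
   Context: $\mathbb{H}_{\mathbb{C}}=\mathbb{H}\otimes_{\mathbb{R}}\mathbb{C}$ is the algebra of complex quaternions: elements are $z=z_0+z_1i+z_2j+z_3k=z_0+z_v$ with $z_0,\dots,z_3\in\mathbb{C}$, where $z_0$ is the scalar part and $z_v=z_1i+z_2j+z_3k$ the vector part. Here $i,j,k$ satisfy $i^2=j^2=k^2=-1$, $ij=-ji=k$, and the complex imaginary unit $\sqrt{-1}$ is central (distinct from $i$). Put $z^c=z_0-z_v$ and $z^s=zz^c=z_0^2+z_1^2+z_2^2+z_3^2\in\mathbb{C}$; if $z^s\neq0$ then $z^{-1}=z^c/z^s$. A function $\Omega\to\mathbb{H}_{\mathbb{C}}$ is holomorphic (meromorphic) if its four complex components are; the operations above are applied pointwise, $\Phi_0$ denotes the scalar part of $\Phi$, and $\chi^{-1}=\chi^c/\chi^s$ is the inverse as a meromorphic function. Vectorial complex quaternions $z_1i+z_2j+z_3k$ are identified with $(z_1,z_2,z_3)\in\mathbb{C}^3$. A smooth parametric surface $X=X(u,v)\colon U\subset\mathbb{R}^2\simeq\mathbb{C}\to\mathbb{R}^3$ is isothermal (given in isothermal coordinates) if $\langle X_u,X_u\rangle=\langle X_v,X_v\rangle>0$ and $\langle X_u,X_v\rangle=0$; it is minimal if its mean curvature vanishes at every point.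
   Formalization: In the first part Φ is additionally assumed not identically zero on Ω, since for Φ ≡ 0 the equation Φ = χLχ⁻¹ with χ invertible would force L = 0. *)

(* Defs.v *)
From Stdlib Require Import Reals Lra.
From Coquelicot Require Import Coquelicot.

Open Scope R_scope.

(** * Complex quaternions *)

Record HC : Type := mkHC { h0 : C; h1 : C; h2 : C; h3 : C }.

Definition HofC (c : C) : HC := mkHC c 0 0 0.

Definition Hmul (a b : HC) : HC :=
  (mkHC
    (h0 a * h0 b - h1 a * h1 b - h2 a * h2 b - h3 a * h3 b)
    (h0 a * h1 b + h1 a * h0 b + h2 a * h3 b - h3 a * h2 b)
    (h0 a * h2 b - h1 a * h3 b + h2 a * h0 b + h3 a * h1 b)
    (h0 a * h3 b + h1 a * h2 b - h2 a * h1 b + h3 a * h0 b))%C.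

Definition Hscale (c : C) (a : HC) : HC :=
  (mkHC (c * h0 a) (c * h1 a) (c * h2 a) (c * h3 a))%C.

Definition Hconj (a : HC) : HC :=
  (mkHC (h0 a) (- h1 a) (- h2 a) (- h3 a))%C.

Definition Hs (a : HC) : C :=
  (h0 a * h0 a + h1 a * h1 a + h2 a * h2 a + h3 a * h3 a)%C.

(** Only meaningful when [Hs a <> 0]. *)
Definition Hinv (a : HC) : HC := Hscale (/ Hs a)%C (Hconj a).

Definition Hi : HC := mkHC 0 1 0 0.
Definition Hj : HC := mkHC 0 0 1 0.
Definition Hk : HC := mkHC 0 0 0 1.
Definition Hadd (a b : HC) : HC :=
  (mkHC (h0 a + h0 b) (h1 a + h1 b) (h2 a + h2 b) (h3 a + h3 b))%C.

Definition HL : HC := Hadd Hi (Hscale Ci Hj).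

Lemma Hmul_ij : Hmul Hi Hj = Hk.
Proof. unfold Hmul, Hk; simpl; f_equal; ring. Qed.

Lemma Hmul_conj (a : HC) : Hmul a (Hconj a) = HofC (Hs a).
Proof. unfold Hmul, Hconj, HofC, Hs; simpl; f_equal; ring. Qed.

Lemma Hmul_inv (a : HC) : Hs a <> 0 -> Hmul a (Hinv a) = HofC 1.
Proof.
intros ha; unfold Hmul, Hinv, HofC; simpl.
f_equal; try ring; unfold Hs in *; field; exact ha.
Qed.

(** * Planar topology *)

Definition subset (A B : C -> Prop) : Prop := forall z, A z -> B z.

Definition connected (D : C -> Prop) : Prop :=
  forall A B : C -> Prop, open A -> open B ->
    (forall z, D z -> A z \/ B z) ->
    (exists z, D z /\ A z) -> (exists z, D z /\ B z) ->
    exists z, D z /\ A z /\ B z.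

Definition planar_domain (D : C -> Prop) : Prop :=
  open D /\ connected D /\ exists z, D z.

(** Loops and homotopies are taken continuous on the whole line and plane,
    which is no restriction: extend from [[0,1]] and [[0,1]^2] by clamping
    the arguments. Path connectedness comes from being used together with
    [planar_domain]. *)
Definition loops_contractible (D : C -> Prop) : Prop :=
  forall g : R -> C,
    (forall t, continuous g t) ->
    (forall t, 0 <= t <= 1 -> D (g t)) ->
    g 0 = g 1 ->
    exists H : R -> R -> C,
      (forall p : R * R, continuous (fun q : R * R => H (fst q) (snd q)) p) /\
      (forall s t, 0 <= s <= 1 -> 0 <= t <= 1 -> D (H s t)) /\
      (forall t, 0 <= t <= 1 -> H 0 t = g t) /\
      (forall t, 0 <= t <= 1 -> H 1 t = g 0) /\
      (forall s, 0 <= s <= 1 -> H s 0 = g 0 /\ H s 1 = g 0).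

Definition simply_connected_domain (D : C -> Prop) : Prop :=
  planar_domain D /\ loops_contractible D.

(** * Holomorphic and meromorphic functions *)

Definition holomorphic (D : C -> Prop) (f : C -> C) : Prop :=
  forall z : C, D z -> @ex_derive C_AbsRing C_NormedModule f z.

(** The value of [f] at [p] itself is irrelevant, and may be arbitrary if [p]
    is a pole. On an open set, [f] is meromorphic at every point exactly when
    it coincides with a meromorphic function off a closed discrete subset. *)
Definition meromorphic_at (f : C -> C) (p : C) : Prop :=
  exists (n : nat) (g : C -> C),
    locally p (fun z => @ex_derive C_AbsRing C_NormedModule g z) /\
    locally' p (fun z => f z = (g z / Cpow (z - p) n)%C).

Definition meromorphic (D : C -> Prop) (f : C -> C) : Prop :=
  forall p : C, D p -> meromorphic_at f p.

Definition componentwise (P : (C -> C) -> Prop) (F : C -> HC) : Prop :=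
  P (fun z => h0 (F z)) /\ P (fun z => h1 (F z)) /\
  P (fun z => h2 (F z)) /\ P (fun z => h3 (F z)).

Definition Hholomorphic (D : C -> Prop) : (C -> HC) -> Prop :=
  componentwise (holomorphic D).

Definition Hmeromorphic (D : C -> Prop) : (C -> HC) -> Prop :=
  componentwise (meromorphic D).

(** [F = chi L chi^-1] as meromorphic functions: [Hs chi] is not identically
    zero near any point, so that [chi^-1] makes sense, and both sides agree
    off a closed discrete subset of [D]. *)
Definition conjugates_L (D : C -> Prop) (F chi : C -> HC) : Prop :=
  forall p : C, D p ->
    locally' p (fun z : C =>
      Hs (chi z) <> 0 /\ F z = Hmul (Hmul (chi z) HL) (Hinv (chi z))).

(** * Surfaces in space *)

Definition R3 : Type := (R * R * R)%type.
Definition x1 (a : R3) : R := fst (fst a).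
Definition x2 (a : R3) : R := snd (fst a).
Definition x3 (a : R3) : R := snd a.

Definition add3 (a b : R3) : R3 := (x1 a + x1 b, x2 a + x2 b, x3 a + x3 b).
Definition scale3 (r : R) (a : R3) : R3 := (r * x1 a, r * x2 a, r * x3 a).
Definition dot (a b : R3) : R := x1 a * x1 b + x2 a * x2 b + x3 a * x3 b.
Definition cross (a b : R3) : R3 :=
  (x2 a * x3 b - x3 a * x2 b,
   x3 a * x1 b - x1 a * x3 b,
   x1 a * x2 b - x2 a * x1 b).
Definition norm3 (a : R3) : R := sqrt (dot a a).

(** The parameter plane is [C = R * R], with [(u, v)] standing for
    [u + sqrt(-1) v]. *)
Definition Du (f : C -> R) (p : C) : R :=
  Derive (fun u => f (u, snd p)) (fst p).
Definition Dv (f : C -> R) (p : C) : R :=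
  Derive (fun v => f (fst p, v)) (snd p).

Fixpoint class_C (n : nat) (U : C -> Prop) (f : C -> R) : Prop :=
  (forall p : C, U p -> continuous f p) /\
  match n with
  | O => True
  | S m =>
      (forall p : C, U p ->
         ex_derive (fun u => f (u, snd p)) (fst p) /\
         ex_derive (fun v => f (fst p, v)) (snd p)) /\
      class_C m U (Du f) /\ class_C m U (Dv f)
  end.

Definition smooth (U : C -> Prop) (X : C -> R3) : Prop :=
  forall n : nat,
    class_C n U (fun p => x1 (X p)) /\
    class_C n U (fun p => x2 (X p)) /\
    class_C n U (fun p => x3 (X p)).

Definition D3u (X : C -> R3) (p : C) : R3 :=
  (Du (fun q => x1 (X q)) p, Du (fun q => x2 (X q)) p, Du (fun q => x3 (X q)) p).
Definition D3v (X : C -> R3) (p : C) : R3 :=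
  (Dv (fun q => x1 (X q)) p, Dv (fun q => x2 (X q)) p, Dv (fun q => x3 (X q)) p).

Definition isothermal (U : C -> Prop) (X : C -> R3) : Prop :=
  forall p : C, U p ->
    dot (D3u X p) (D3u X p) = dot (D3v X p) (D3v X p) /\
    0 < dot (D3u X p) (D3u X p) /\
    dot (D3u X p) (D3v X p) = 0.

Definition unit_normal (X : C -> R3) (p : C) : R3 :=
  let n := cross (D3u X p) (D3v X p) in scale3 (/ norm3 n) n.

Definition mean_curvature (X : C -> R3) (p : C) : R :=
  let E := dot (D3u X p) (D3u X p) in
  let F := dot (D3u X p) (D3v X p) in
  let G := dot (D3v X p) (D3v X p) in
  let N := unit_normal X p in
  let e := dot (D3u (D3u X) p) N in
  let f := dot (D3v (D3u X) p) N in
  let g := dot (D3v (D3v X) p) N in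
  (e * G - 2 * f * F + g * E) / (2 * (E * G - F * F)).

Definition minimal (U : C -> Prop) (X : C -> R3) : Prop :=
  forall p : C, U p -> mean_curvature X p = 0.

(** * Curves and path integrals *)

Definition path_derive (g : R -> C) (t : R) : C :=
  (Derive (fun s => fst (g s)) t, Derive (fun s => snd (g s)) t).

Definition C1_path (g : R -> C) : Prop :=
  forall t, ex_derive (fun s => fst (g s)) t /\
            ex_derive (fun s => snd (g s)) t /\
            continuous (path_derive g) t.

Definition piecewise_C1 (g : R -> C) : Prop :=
  exists (N : nat) (s : nat -> R),
    s O = 0 /\ s N = 1 /\
    forall k, (k < N)%nat ->
      s k < s (S k) /\
      exists h : R -> C, C1_path h /\
        forall t, s k <= t <= s (S k) -> g t = h t.

(** Injective on [[0,1]], except that the endpoints may coincide. *)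
Definition simple_path (g : R -> C) : Prop :=
  forall s t, 0 <= s -> s < t -> t <= 1 -> g s = g t -> s = 0 /\ t = 1.

Definition simple_curve_in (D : C -> Prop) (z0 z : C) (g : R -> C) : Prop :=
  piecewise_C1 g /\ simple_path g /\
  (forall t, 0 <= t <= 1 -> D (g t)) /\ g 0 = z0 /\ g 1 = z.

Definition path_integral (f : C -> C) (g : R -> C) : C :=
  RInt (V := C_R_CompleteNormedModule)
    (fun t => (f (g t) * path_derive g t)%C) 0 1.

(** Real part of the integral of the vectorial quaternion
    [h1 i + h2 j + h3 k], seen in [C^3]. *)
Definition Re_path_integral (F : C -> HC) (g : R -> C) : R3 :=
  (Re (path_integral (fun z => h1 (F z)) g),
   Re (path_integral (fun z => h2 (F z)) g),
   Re (path_integral (fun z => h3 (F z)) g)).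

(* Main.v *)
Require Import Defs.
From Stdlib Require Import Reals Lra Lia ClassicalEpsilon.
From Coquelicot Require Import Coquelicot.

Open Scope R_scope.

(** Since [Phi Phi = L L = 0], the function [chi = Phi + L] satisfies
    [Phi chi = chi L], and [chi^s = 2 (Phi_1 + sqrt(-1) Phi_2)]. Where this
    vanishes identically, [Phi = Phi_1 L] and
    [chi = (Phi_1 + 1) + sqrt(-1) (Phi_1 - 1) k] works instead. That one of the
    two cases prevails near each point is the isolation of zeros of a
    complex-differentiable function, which follows from Goursat's argument
    (bisecting the parameter rectangle of a homotopy of circles) through
    Cauchy's formula and the geometric series.

    For a surface, [Phi = X_u - sqrt(-1) X_v]: differentiating the isothermal
    conditions shows that the Laplacian of [X] is normal to the surface, and
    minimality kills the normal part, so that [Phi] satisfies the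
    Cauchy-Riemann equations; [X] is recovered by the chain rule. *)

(** * Nested bisection of rectangles *)

(** Some non-vanishing of [Phi] has to be assumed: [chi L chi^-1 = 0] with [chi] invertible would
    give [L = 0]. On a connected domain one nonzero value is enough; for a surface, regularity
    provides nonzero values at every point. The two choices of [chi] may prevail on different
    components of an open set, so [chi] is glued from germs, and only the local dichotomy for zeros
    enters.

    Holomorphy means differentiability at each point, without continuity of the derivative, hence
    Goursat. Working in the parameter rectangle of a homotopy leads from a small circle about [w] to
    a large circle about the origin in one step, without winding numbers or contours in the plane.
    No power series is summed: a recursion between Cauchy-type integrals divides [f] by one power of
    the variable at a time, and a uniform bound on these integrals does the rest. *)

Lemma nested_common (a b : nat -> R) :
  (forall n, a n <= a (S n)) -> (forall n, b (S n) <= b n) ->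
  (forall n, a n <= b n) ->
  exists x, forall n, a n <= x <= b n.
Proof.
intros ha hb hab.
assert (ma : forall n k, a n <= a (n + k)%nat).
{ intros n k; induction k as [|k IH]; [rewrite Nat.add_0_r; lra|].
  rewrite Nat.add_succ_r; specialize (ha (n + k)%nat); lra. }
assert (mb : forall n k, b (n + k)%nat <= b n).
{ intros n k; induction k as [|k IH]; [rewrite Nat.add_0_r; lra|].
  rewrite Nat.add_succ_r; specialize (hb (n + k)%nat); lra. }
assert (mab : forall m n, a m <= b n).
{ intros m n.
  pose proof (ma m n); pose proof (mb n m).
  rewrite (Nat.add_comm n m) in *; specialize (hab (m + n)%nat); lra. }
destruct (completeness (fun y => exists n, y = a n)) as [x [ub lub]].
- exists (b O); intros y [n ->]; apply mab.
- exists (a O); exists O; reflexivity.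
- exists x; intros n; split.
  + apply ub; exists n; reflexivity.
  + apply lub; intros y [m ->]; apply mab.
Qed.

Record rect : Type := mkRect { rl : R; rr : R; rb : R; rt : R }.

Definition rect_in (q q0 : rect) : Prop :=
  rl q0 <= rl q /\ rl q <= rr q /\ rr q <= rr q0 /\
  rb q0 <= rb q /\ rb q <= rt q /\ rt q <= rt q0.

Definition quarters (q : rect) : rect * rect * rect * rect :=
  let m := (rl q + rr q) / 2 in
  let n := (rb q + rt q) / 2 in
  (mkRect (rl q) m (rb q) n, mkRect m (rr q) (rb q) n,
   mkRect (rl q) m n (rt q), mkRect m (rr q) n (rt q)).

Definition worst_quarter (I : rect -> R) (q : rect) : rect :=
  let '(q1, q2, q3, q4) := quarters q in
  if Rle_dec (I q / 4) (I q1) then q1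
  else if Rle_dec (I q / 4) (I q2) then q2
  else if Rle_dec (I q / 4) (I q3) then q3 else q4.

(** If each of the first three quarters carries less than [I q / 4], subadditivity leaves at least
    that much to the fourth, which is the default. *)
Lemma worst_quarter_spec (I : rect -> R) (q : rect) :
  rl q <= rr q -> rb q <= rt q ->
  (let '(q1, q2, q3, q4) := quarters q in I q <= I q1 + I q2 + I q3 + I q4) ->
  rect_in (worst_quarter I q) q /\
  I q / 4 <= I (worst_quarter I q) /\
  rr (worst_quarter I q) - rl (worst_quarter I q) = (rr q - rl q) / 2 /\
  rt (worst_quarter I q) - rb (worst_quarter I q) = (rt q - rb q) / 2.
Proof.
unfold worst_quarter, quarters; intros h1 h2 hI.
repeat (destruct Rle_dec); unfold rect_in; simpl; repeat split; lra.
Qed.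

(** If [I q0] were positive, repeated choice of the worst quarter would keep [I] at least
    [4^-n I q0], while near the common point of the rectangles the local estimate bounds it by
    [eps 4^-n W^2], with [W] the half-perimeter of [q0]. *)
Lemma bisection_nonpos (I : rect -> R) (q0 : rect) :
  rl q0 <= rr q0 -> rb q0 <= rt q0 ->
  (forall q, rect_in q q0 ->
     let '(q1, q2, q3, q4) := quarters q in I q <= I q1 + I q2 + I q3 + I q4) ->
  (forall x y, rl q0 <= x <= rr q0 -> rb q0 <= y <= rt q0 ->
     forall eps, 0 < eps -> exists delta, 0 < delta /\
       forall q, rect_in q q0 -> rl q <= x <= rr q -> rb q <= y <= rt q ->
         rr q - rl q < delta -> rt q - rb q < delta ->
         I q <= eps * ((rr q - rl q) + (rt q - rb q)) ^ 2) ->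
  I q0 <= 0.
Proof.
intros hx hy hsub hloc.
set (q := fun n => Nat.iter n (worst_quarter I) q0).
assert (hq : forall n, rect_in (q n) q0).
{ intros n; induction n as [|n IH].
  - unfold rect_in; simpl; lra.
  - change (q (S n)) with (worst_quarter I (q n)).
    destruct (worst_quarter_spec I (q n)) as [h _]; try (apply hsub; exact IH);
      unfold rect_in in *; lra. }
assert (hs : forall n, rect_in (q (S n)) (q n) /\ I (q n) / 4 <= I (q (S n)) /\
   rr (q (S n)) - rl (q (S n)) = (rr (q n) - rl (q n)) / 2 /\
   rt (q (S n)) - rb (q (S n)) = (rt (q n) - rb (q n)) / 2).
{ intros n; apply worst_quarter_spec; try (apply hsub; apply hq);
    specialize (hq n); unfold rect_in in hq; lra. }
assert (hp : forall n, 0 < (/ 2) ^ n) by (intros n; apply pow_lt; lra).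
assert (hI : forall n, I q0 * ((/ 2) ^ n) ^ 2 <= I (q n) /\
   rr (q n) - rl (q n) = (rr q0 - rl q0) * (/ 2) ^ n /\
   rt (q n) - rb (q n) = (rt q0 - rb q0) * (/ 2) ^ n).
{ intros n; induction n as [|n IH].
  - simpl; lra.
  - destruct (hs n) as [_ [h1 [h2 h3]]]; rewrite h2, h3; simpl ((/ 2) ^ S n).
    destruct IH as [i1 [-> ->]]; repeat split; lra. }
destruct (nested_common (fun n => rl (q n)) (fun n => rr (q n))) as [x hxn];
  try (intros n; destruct (hs n) as [h _]; specialize (hq n);
       unfold rect_in in *; lra).
destruct (nested_common (fun n => rb (q n)) (fun n => rt (q n))) as [y hyn];
  try (intros n; destruct (hs n) as [h _]; specialize (hq n);
       unfold rect_in in *; lra).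
destruct (Rle_lt_dec (I q0) 0) as [h0|h0]; [exact h0|exfalso].
set (W := (rr q0 - rl q0) + (rt q0 - rb q0)).
assert (hW : 0 <= W) by (unfold W; lra).
(* With this [eps] the bound is below [4^-n I q0], because [W^2 / (2 (W^2 + 1)) < 1]; the [+ 1]
   keeps [eps] defined when [W = 0]. *)
destruct (hloc x y (hxn O) (hyn O) (I q0 / (2 * (W ^ 2 + 1)))) as [d [hd hb]].
{ apply Rdiv_lt_0_compat; nra. }
destruct (pow_lt_1_zero (/ 2)) with (y := d / (W + 1)) as [N hN].
{ rewrite Rabs_pos_eq; lra. }
{ apply Rdiv_lt_0_compat; lra. }
specialize (hN N (le_n N)).
rewrite Rabs_pos_eq in hN by (left; apply hp).
destruct (hI N) as [h1 [h2 h3]].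
assert (hd' : (/ 2) ^ N * (W + 1) < d).
{ apply (Rmult_lt_compat_r (W + 1)) in hN; [|lra].
  unfold Rdiv in hN; rewrite Rmult_assoc, Rinv_l in hN; lra. }
specialize (hp N).
assert (hfin := hb (q N) (hq N) (hxn N) (hyn N)).
rewrite h2, h3 in hfin.
assert (hfin' := hfin ltac:(unfold W in *; nra) ltac:(unfold W in *; nra)).
replace ((rr q0 - rl q0) * (/ 2) ^ N + (rt q0 - rb q0) * (/ 2) ^ N)
  with (W * (/ 2) ^ N) in hfin' by (unfold W; ring).
assert (hc : I q0 / (2 * (W ^ 2 + 1)) * W ^ 2 < I q0).
{ apply (Rmult_lt_reg_r (2 * (W ^ 2 + 1))); [nra|].
  replace (I q0 / (2 * (W ^ 2 + 1)) * W ^ 2 * (2 * (W ^ 2 + 1)))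
    with (I q0 * W ^ 2) by (field; nra).
  nra. }
rewrite Rpow_mult_distr in hfin'.
assert (0 < ((/ 2) ^ N) ^ 2) by (apply pow_lt; lra).
nra.
Qed.

(** * Continuity and differentiability of complex functions *)

Lemma locally_Cmod (p : C) (P : C -> Prop) :
  locally p P <-> exists d, 0 < d /\ forall z, Cmod (z - p) < d -> P z.
Proof.
split.
- intros h; apply locally_C in h; destruct h as [d hd].
  exists d; split; [apply cond_pos|]; intros z hz; apply hd; exact hz.
- intros [d [hd h]]; apply locally_C; exists (mkposreal d hd).
  intros z hz; apply h; exact hz.
Qed.

Lemma locally'_Cmod (p : C) (P : C -> Prop) :
  locally' p P <-> exists d, 0 < d /\
    forall z, z <> p -> Cmod (z - p) < d -> P z.
Proof.
unfold locally', within; rewrite locally_Cmod.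
split; intros [d [hd h]]; exists d; split; auto.
Qed.

Lemma continuous_Cmod (U : UniformSpace) (f : U -> C) (x : U) :
  continuous f x <->
  forall eps, 0 < eps -> locally x (fun y => Cmod (f y - f x) < eps).
Proof.
split.
- intros h eps he; apply (h (fun z => Cmod (z - f x) < eps)).
  apply locally_Cmod; exists eps; auto.
- intros h P hP; apply locally_Cmod in hP; destruct hP as [d [hd hP]].
  unfold filtermap; eapply filter_imp; [|apply (h d hd)].
  intros y; apply hP.
Qed.

(* [ring] and [field] fail when the equality is stated over a Coquelicot
   structure carried by [C] instead of [C] itself. *)
Ltac Cring :=
  match goal with |- @eq _ ?a ?b => change (@eq C a b) end; ring.

Ltac Cfield :=
  match goal with |- @eq _ ?a ?b => change (@eq C a b) end; field.

Lemma Cminus_neq_0 (a b : C) : a <> b -> (a - b)%C <> 0.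
Proof. intros n e; apply n; rewrite <- (Cplus_0_l b), <- e; Cring. Qed.

Section Continuity.
Context {U : UniformSpace}.
Implicit Types (f g : U -> C) (x : U).

Lemma continuous_pair f x :
  continuous (fun y => fst (f y)) x -> continuous (fun y => snd (f y)) x ->
  continuous f x.
Proof.
intros h1 h2 P [e he].
specialize (h1 _ (locally_ball (fst (f x)) e)).
specialize (h2 _ (locally_ball (snd (f x)) e)).
unfold filtermap in *; generalize (filter_and _ _ h1 h2).
apply filter_imp; intros y hy; apply he; exact hy.
Qed.

Lemma continuous_Re f x : continuous f x -> continuous (fun y => fst (f y)) x.
Proof.
intros h; apply (continuous_comp f (fun z : C => fst z)); [exact h|].
destruct (f x); apply continuous_fst.
Qed.

Lemma continuous_Im f x : continuous f x -> continuous (fun y => snd (f y)) x.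
Proof.
intros h; apply (continuous_comp f (fun z : C => snd z)); [exact h|].
destruct (f x); apply continuous_snd.
Qed.

Lemma continuous_Rmult (u v : U -> R) x :
  continuous u x -> continuous v x -> continuous (fun y => u y * v y) x.
Proof. apply (continuous_mult (K := R_AbsRing) u v). Qed.

Lemma continuous_Rplus (u v : U -> R) x :
  continuous u x -> continuous v x -> continuous (fun y => u y + v y) x.
Proof. apply (continuous_plus (V := R_NormedModule) u v). Qed.

Lemma continuous_Ropp (u : U -> R) x :
  continuous u x -> continuous (fun y => - u y) x.
Proof. apply (continuous_opp (V := R_NormedModule) u). Qed.

Lemma continuous_Cplus f g x :
  continuous f x -> continuous g x -> continuous (fun y => f y + g y)%C x.
Proof.
intros hf hg; apply continuous_pair; simpl; apply continuous_Rplus;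
  auto using continuous_Re, continuous_Im.
Qed.

Lemma continuous_Copp f x :
  continuous f x -> continuous (fun y => - f y)%C x.
Proof.
intros hf; apply continuous_pair; simpl; apply continuous_Ropp;
  auto using continuous_Re, continuous_Im.
Qed.

Lemma continuous_Cminus f g x :
  continuous f x -> continuous g x -> continuous (fun y => f y - g y)%C x.
Proof. intros hf hg; apply continuous_Cplus; auto using continuous_Copp. Qed.

Lemma continuous_Cmult f g x :
  continuous f x -> continuous g x -> continuous (fun y => f y * g y)%C x.
Proof.
intros hf hg.
pose proof (continuous_Re _ _ hf); pose proof (continuous_Im _ _ hf).
pose proof (continuous_Re _ _ hg); pose proof (continuous_Im _ _ hg).
apply continuous_pair; simpl.
- apply (continuous_Rplus (fun y => fst (f y) * fst (g y))
    (fun y => - (snd (f y) * snd (g y)))).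
  + apply (continuous_Rmult (fun y => fst (f y)) (fun y => fst (g y))); assumption.
  + apply (continuous_Ropp (fun y => snd (f y) * snd (g y))).
    apply (continuous_Rmult (fun y => snd (f y)) (fun y => snd (g y))); assumption.
- apply (continuous_Rplus (fun y => fst (f y) * snd (g y))
    (fun y => snd (f y) * fst (g y))).
  + apply (continuous_Rmult (fun y => fst (f y)) (fun y => snd (g y))); assumption.
  + apply (continuous_Rmult (fun y => snd (f y)) (fun y => fst (g y))); assumption.
Qed.

Lemma continuous_Cinv f x :
  f x <> 0 -> continuous f x -> continuous (fun y => / f y)%C x.
Proof.
intros h0 hf.
assert (hn : fst (f x) ^ 2 + snd (f x) ^ 2 <> 0).
{ intros h; apply h0; apply injective_projections; simpl; nra. }
assert (hc : continuous (fun y => / (fst (f y) ^ 2 + snd (f y) ^ 2)) x).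
{ apply (continuous_comp (fun y => fst (f y) ^ 2 + snd (f y) ^ 2) Rinv);
    [|apply continuous_Rinv; exact hn].
  apply (continuous_Rplus (fun y => fst (f y) ^ 2) (fun y => snd (f y) ^ 2)).
  - apply (continuous_comp (fun y => fst (f y)) (fun r => r ^ 2));
      [apply continuous_Re; exact hf|].
    apply (ex_derive_continuous (fun r => r ^ 2)); auto_derive; trivial.
  - apply (continuous_comp (fun y => snd (f y)) (fun r => r ^ 2));
      [apply continuous_Im; exact hf|].
    apply (ex_derive_continuous (fun r => r ^ 2)); auto_derive; trivial. }
apply continuous_pair; simpl.
- apply (continuous_Rmult (fun y => fst (f y))
    (fun y => / (fst (f y) ^ 2 + snd (f y) ^ 2))); [|exact hc].
  apply continuous_Re; exact hf.
- apply (continuous_Rmult (fun y => - snd (f y))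
    (fun y => / (fst (f y) ^ 2 + snd (f y) ^ 2))); [|exact hc].
  apply (continuous_Ropp (fun y => snd (f y))), continuous_Im; exact hf.
Qed.

Lemma continuous_Cconst (c : C) x : continuous (fun _ : U => c) x.
Proof. apply continuous_const. Qed.

End Continuity.

(* Caratheodory's form of complex differentiability: the difference quotient
   extends continuously to [z]. *)
Definition Cdifferentiable (f : C -> C) (z : C) : Prop :=
  exists phi : C -> C, continuous phi z /\
    locally z (fun y => f y - f z = phi y * (y - z))%C.

Lemma ex_derive_Cmod (f : C -> C) (z : C) :
  @ex_derive C_AbsRing C_NormedModule f z <->
  exists l : C, forall eps, 0 < eps -> exists d, 0 < d /\
    forall y, Cmod (y - z) < d ->
      Cmod (f y - f z - (y - z) * l) <= eps * Cmod (y - z).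
Proof.
split.
- intros [l [_ hl]]; exists l; intros eps he.
  destruct (hl z (fun P h => h) (mkposreal eps he)) as [d hd].
  exists d; split; [apply cond_pos|]; intros y hy.
  specialize (hd y hy); simpl in hd.
  change (norm (K := C_AbsRing) (V := C_NormedModule)) with Cmod in hd.
  exact hd.
- intros [l hl]; exists l; split; [apply is_linear_scal_l|].
  intros x hx.
  assert (hxz : z = x).
  { apply (is_filter_lim_locally_unique (V := AbsRing_NormedModule C_AbsRing)); exact hx. }
  subst x; intros eps; destruct (hl eps (cond_pos eps)) as [d [hd h]].
  exists (mkposreal d hd); intros y hy; exact (h y hy).
Qed.

Lemma Cdifferentiable_iff (f : C -> C) (z : C) :
  @ex_derive C_AbsRing C_NormedModule f z <-> Cdifferentiable f z.
Proof.
rewrite ex_derive_Cmod; split.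
- intros [l hl].
  (* The difference quotient, completed at [z] by the derivative. *)
  exists (fun y => match Ceq_dec y z with
                   | left _ => l
                   | right _ => ((f y - f z) / (y - z))%C end).
  split.
  + apply continuous_Cmod; intros eps he; apply locally_Cmod.
    destruct (hl (eps / 2) ltac:(lra)) as [d [hd h]]; exists d; split; [exact hd|].
    intros y hy; destruct (Ceq_dec z z) as [_|n]; [|congruence].
    destruct (Ceq_dec y z) as [e|n].
    * replace (l - l)%C with (RtoC 0) by ring; rewrite Cmod_0; lra.
    * assert (hn : (y - z)%C <> 0)
        by (apply Cminus_neq_0; exact n).
      specialize (h y hy).
      assert (hp : 0 < Cmod (y - z)) by (apply Cmod_gt_0; exact hn).
      replace ((f y - f z) / (y - z) - l)%C
        with ((f y - f z - (y - z) * l) / (y - z))%C by (field; exact hn).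
      rewrite Cmod_div by exact hn.
      apply Rle_lt_trans with (eps / 2); [|lra].
      apply (Rmult_le_reg_r (Cmod (y - z))); [exact hp|].
      unfold Rdiv at 1; rewrite Rmult_assoc, Rinv_l by lra; lra.
  + apply filter_forall; intros y; destruct (Ceq_dec y z) as [->|n]; [Cring|].
    Cfield; apply Cminus_neq_0; exact n.
- intros [phi [hc he]]; exists (phi z); intros eps heps.
  apply continuous_Cmod with (eps := eps) in hc; [|exact heps].
  generalize (filter_and _ _ hc he); intros h.
  apply locally_Cmod in h; destruct h as [d [hd h]].
  exists d; split; [exact hd|]; intros y hy.
  destruct (h y hy) as [h1 h2]; rewrite h2.
  replace (phi y * (y - z) - (y - z) * phi z)%C
    with ((phi y - phi z) * (y - z))%C by ring.
  rewrite Cmod_mult; apply Rmult_le_compat_r; [apply Cmod_ge_0|lra].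
Qed.

Lemma Cdifferentiable_continuous (f : C -> C) (z : C) :
  Cdifferentiable f z -> continuous f z.
Proof.
intros [phi [hc he]].
apply (continuous_ext_loc _ (fun y => f z + phi y * (y - z))%C).
- revert he; apply filter_imp; intros y hy; rewrite <- hy; Cring.
- apply continuous_Cplus; [apply continuous_Cconst|].
  apply continuous_Cmult; [exact hc|].
  apply continuous_Cminus; [apply continuous_id|apply continuous_Cconst].
Qed.

Lemma Cdifferentiable_mult (f g : C -> C) (z : C) :
  Cdifferentiable f z -> Cdifferentiable g z ->
  Cdifferentiable (fun y => f y * g y)%C z.
Proof.
intros hf hg; assert (hcg := Cdifferentiable_continuous _ _ hg).
destruct hf as [phi [hc he]], hg as [psi [hc' he']].
exists (fun y => phi y * g y + f z * psi y)%C; split.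
- apply continuous_Cplus; apply continuous_Cmult; auto using continuous_Cconst.
- generalize (filter_and _ _ he he'); apply filter_imp; intros y [h1 h2].
  replace (f y * g y - f z * g z)%C
    with ((f y - f z) * g y + f z * (g y - g z))%C by Cring.
  rewrite h1, h2; Cring.
Qed.

Lemma Cdifferentiable_plus (f g : C -> C) (z : C) :
  Cdifferentiable f z -> Cdifferentiable g z ->
  Cdifferentiable (fun y => f y + g y)%C z.
Proof.
intros [phi [hc he]] [psi [hc' he']].
exists (fun y => phi y + psi y)%C; split; [apply continuous_Cplus; auto|].
generalize (filter_and _ _ he he'); apply filter_imp; intros y [h1 h2].
replace (f y + g y - (f z + g z))%C
  with ((f y - f z) + (g y - g z))%C by Cring.
rewrite h1, h2; Cring.
Qed.

Lemma Cdifferentiable_const (c z : C) : Cdifferentiable (fun _ => c) z.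
Proof.
exists (fun _ => RtoC 0); split; [apply continuous_Cconst|].
apply filter_forall; intros y; Cring.
Qed.

Lemma Cdifferentiable_shift (f : C -> C) (p z : C) :
  Cdifferentiable f (p + z)%C -> Cdifferentiable (fun y => f (p + y)%C) z.
Proof.
intros [phi [hc he]].
assert (ht : continuous (fun y : C => p + y)%C z).
{ apply continuous_Cplus; [apply continuous_Cconst|apply continuous_id]. }
exists (fun y => phi (p + y)%C); split.
- apply (continuous_comp (fun y : C => p + y)%C phi); auto.
- specialize (ht _ he); revert ht; unfold filtermap; apply filter_imp.
  intros y ->; Cring.
Qed.

Lemma Cdifferentiable_inv_minus (w z : C) :
  z <> w -> Cdifferentiable (fun y => / (y - w))%C z.
Proof.
intros hzw; assert (hn := Cminus_neq_0 _ _ hzw).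
(* The difference of the two reciprocals is [- (y - z) / ((y - w) (z - w))]; within distance
   [|z - w|] of [z] the point [y] cannot meet [w]. *)
exists (fun y => - (/ (y - w) * / (z - w)))%C; split.
- apply continuous_Copp, continuous_Cmult; [|apply continuous_Cconst].
  apply continuous_Cinv; [exact hn|].
  apply continuous_Cminus; [apply continuous_id|apply continuous_Cconst].
- apply locally_Cmod; exists (Cmod (z - w)); split; [apply Cmod_gt_0; exact hn|].
  intros y hy; Cfield; split; [exact hn|].
  intros e; assert (hyw : y = w) by (rewrite <- (Cplus_0_l w), <- e; Cring).
  rewrite hyw in hy; rewrite <- Cmod_opp in hy.
  replace (- (w - z))%C with (z - w)%C in hy by Cring; lra.
Qed.

(** * Integrals of complex-valued functions and Goursat's theorem *)

Notation is_CRInt := (is_RInt (V := C_R_NormedModule)).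
Notation CRInt := (RInt (V := C_R_CompleteNormedModule)).
Notation is_CRderive := (is_derive (K := R_AbsRing) (V := C_R_NormedModule)).

Lemma is_CRderive_pair (f : R -> C) (t : R) (l : C) :
  is_CRderive f t l <->
  is_derive (fun s => fst (f s)) t (fst l) /\
  is_derive (fun s => snd (f s)) t (snd l).
Proof.
split.
- intros [_ h]; split; (split; [apply is_linear_scal_l|]);
  intros x hx eps; generalize (h x hx eps); apply filter_imp;
  intros y hy; eapply Rle_trans; try exact hy;
  rewrite <- Cmod_norm.
  + eapply Rle_trans; [|apply Rmax_Cmod]; apply Rmax_l.
  + eapply Rle_trans; [|apply Rmax_Cmod]; apply Rmax_r.
- intros [[_ h1] [_ h2]]; split; [apply is_linear_scal_l|].
  intros x hx eps.
  (* Halving [eps] absorbs the factor [sqrt 2 <= 2] by which the modulus may exceed the larger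
     component. *)
  assert (he : 0 < eps / 2) by (destruct eps; simpl; lra).
  generalize (filter_and _ _ (h1 x hx (mkposreal _ he)) (h2 x hx (mkposreal _ he))).
  apply filter_imp; intros y [i1 i2]; simpl in i1, i2.
  rewrite <- Cmod_norm.
  eapply Rle_trans; [apply Cmod_2Rmax|].
  set (N := norm (minus y x)) in *.
  assert (0 <= N) by apply norm_ge_0.
  assert (sqrt 2 <= 2).
  { rewrite <- (sqrt_square 2) at 2 by lra; apply sqrt_le_1; lra. }
  assert (0 <= sqrt 2) by apply sqrt_pos.
  apply Rle_trans with (sqrt 2 * (eps / 2 * N)).
  + apply Rmult_le_compat_l; [assumption|]; apply Rmax_lub; [exact i1|exact i2].
  + assert (0 <= eps / 2 * N) by (apply Rmult_le_pos; [lra|assumption]).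
    assert (h : sqrt 2 * (eps / 2 * N) <= 2 * (eps / 2 * N))
      by (apply Rmult_le_compat_r; assumption).
    eapply Rle_trans; [exact h|]; change (2 * (eps / 2 * N) <= eps * N); lra.
Qed.

Lemma is_CRderive_mult (f g : R -> C) (t : R) (df dg : C) :
  is_CRderive f t df -> is_CRderive g t dg ->
  is_CRderive (fun s => f s * g s)%C t (df * g t + f t * dg)%C.
Proof.
rewrite !is_CRderive_pair; intros [f1 f2] [g1 g2]; simpl; split.
- replace (_ + _) with ((fst df * fst (g t) + fst (f t) * fst dg)
    - (snd df * snd (g t) + snd (f t) * snd dg)) by ring.
  apply (is_derive_minus (V := R_NormedModule) (fun s => fst (f s) * fst (g s))
    (fun s => snd (f s) * snd (g s)));
    apply (is_derive_mult (K := R_AbsRing)); auto; apply Rmult_comm.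
- replace (_ + _) with ((fst df * snd (g t) + fst (f t) * snd dg)
    + (snd df * fst (g t) + snd (f t) * fst dg)) by ring.
  apply (is_derive_plus (V := R_NormedModule) (fun s => fst (f s) * snd (g s))
    (fun s => snd (f s) * fst (g s)));
    apply (is_derive_mult (K := R_AbsRing)); auto; apply Rmult_comm.
Qed.

Lemma is_CRderive_plus (f g : R -> C) (t : R) (df dg : C) :
  is_CRderive f t df -> is_CRderive g t dg ->
  is_CRderive (fun s => f s + g s)%C t (df + dg)%C.
Proof. apply (is_derive_plus (V := C_R_NormedModule)). Qed.

Lemma is_CRderive_const (c : C) (t : R) : is_CRderive (fun _ => c) t (RtoC 0).
Proof. apply (is_derive_const (V := C_R_NormedModule)). Qed.

Lemma CRInt_correct (f : R -> C) (a b : R) :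
  a <= b -> (forall t, a <= t <= b -> continuous f t) -> is_CRInt f a b (CRInt f a b).
Proof.
intros hab hf; apply (RInt_correct (V := C_R_CompleteNormedModule)).
apply (ex_RInt_continuous (V := C_R_CompleteNormedModule)).
rewrite Rmin_left, Rmax_right by exact hab; exact hf.
Qed.

Lemma is_CRInt_unique (f : R -> C) (a b : R) (l : C) :
  is_CRInt f a b l -> CRInt f a b = l.
Proof. apply (is_RInt_unique (V := C_R_CompleteNormedModule)). Qed.

Lemma is_CRInt_plus (f g : R -> C) (a b : R) (l m : C) :
  is_CRInt f a b l -> is_CRInt g a b m ->
  is_CRInt (fun t => f t + g t)%C a b (l + m)%C.
Proof. apply (is_RInt_plus (V := C_R_NormedModule)). Qed.

Lemma is_CRInt_minus (f g : R -> C) (a b : R) (l m : C) :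
  is_CRInt f a b l -> is_CRInt g a b m ->
  is_CRInt (fun t => f t - g t)%C a b (l - m)%C.
Proof. apply (is_RInt_minus (V := C_R_NormedModule)). Qed.

(** The integral is taken over the real module structure, where only real factors are scalars; a
    complex factor is expanded into components. *)
Lemma is_CRInt_mult (c : C) (f : R -> C) (a b : R) (l : C) :
  is_CRInt f a b l -> is_CRInt (fun t => c * f t)%C a b (c * l)%C.
Proof.
intros h.
assert (h1 := is_RInt_fct_extend_fst _ _ _ _ h).
assert (h2 := is_RInt_fct_extend_snd _ _ _ _ h).
apply (is_RInt_fct_extend_pair (U := R_NormedModule) (V := R_NormedModule)); simpl.
- apply (is_RInt_minus (V := R_NormedModule)
    (fun t => fst c * fst (f t)) (fun t => snd c * snd (f t)));
    apply (is_RInt_scal (V := R_NormedModule)); assumption.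
- apply (is_RInt_plus (V := R_NormedModule)
    (fun t => fst c * snd (f t)) (fun t => snd c * fst (f t)));
    apply (is_RInt_scal (V := R_NormedModule)); assumption.
Qed.

Lemma is_CRInt_derive (f df : R -> C) (a b : R) :
  a <= b ->
  (forall t, a <= t <= b -> is_CRderive f t (df t)) ->
  (forall t, a <= t <= b -> continuous df t) ->
  is_CRInt df a b (f b - f a)%C.
Proof.
intros hab hd hc.
apply (is_RInt_derive (V := C_R_CompleteNormedModule) f df);
  rewrite Rmin_left, Rmax_right by exact hab; assumption.
Qed.

Lemma Cmod_is_CRInt_le (f : R -> C) (a b M : R) (l : C) :
  a <= b -> (forall t, a <= t <= b -> Cmod (f t) <= M) ->
  is_CRInt f a b l -> Cmod l <= (b - a) * M.
Proof.
intros hab hM h; rewrite Cmod_norm.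
apply (norm_RInt_le_const (V := C_R_NormedModule) f); [exact hab| |exact h].
intros t ht; rewrite <- Cmod_norm; apply hM; exact ht.
Qed.

Lemma CRInt_Chasles (f : R -> C) (a b c : R) :
  a <= b -> b <= c -> (forall t, a <= t <= c -> continuous f t) ->
  (CRInt f a c = CRInt f a b + CRInt f b c)%C.
Proof.
intros hab hbc hc; symmetry.
apply (RInt_Chasles (V := C_R_CompleteNormedModule));
apply (ex_RInt_continuous (V := C_R_CompleteNormedModule));
rewrite Rmin_left, Rmax_right by assumption; intros t ht; apply hc; lra.
Qed.

Lemma is_CRderive_continuous (f : R -> C) (t : R) (l : C) :
  is_CRderive f t l -> continuous f t.
Proof.
intros h; apply (ex_derive_continuous (V := C_R_NormedModule)).
exists l; exact h.
Qed.

Lemma Cmod_increment_le (e de : R -> C) (a b K : R) :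
  a <= b ->
  (forall t, a <= t <= b -> is_CRderive e t (de t)) ->
  (forall t, a <= t <= b -> continuous de t) ->
  (forall t, a <= t <= b -> Cmod (de t) <= K) ->
  Cmod (e b - e a) <= (b - a) * K.
Proof.
intros hab hd hc hK; apply (Cmod_is_CRInt_le de); auto using is_CRInt_derive.
Qed.

(* An affine integrand has the primitive [z -> g0 z + g1 (z - z0)^2 / 2], so
   only the deviation of [g] from it contributes. *)
Lemma path_integral_affine_le (g : C -> C) (e de : R -> C) (a b K M : R)
    (g0 g1 z0 : C) :
  a <= b -> 0 <= M ->
  (forall t, a <= t <= b -> is_CRderive e t (de t)) ->
  (forall t, a <= t <= b -> continuous de t) ->
  (forall t, a <= t <= b -> continuous g (e t)) ->
  (forall t, a <= t <= b -> Cmod (de t) <= K) ->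
  (forall t, a <= t <= b -> Cmod (g (e t) - (g0 + g1 * (e t - z0))) <= M) ->
  let H z := (g0 * z + g1 * ((z - z0) * (z - z0)) / 2)%C in
  Cmod (CRInt (fun t => g (e t) * de t)%C a b - (H (e b) - H (e a)))
    <= (b - a) * (M * K).
Proof.
intros hab hM hd hc hg hK hgM H.
assert (he : forall t, a <= t <= b -> continuous e t).
{ intros t ht; apply (is_CRderive_continuous _ _ _ (hd t ht)). }
assert (hcg : forall t, a <= t <= b -> continuous (fun t => g (e t)) t).
{ intros t ht; apply (continuous_comp e g); auto. }
assert (hca : forall t, a <= t <= b ->
  continuous (fun t => (g0 + g1 * (e t - z0)) * de t)%C t).
{ intros t ht; apply continuous_Cmult; [|apply hc; exact ht].
  apply continuous_Cplus; [apply continuous_Cconst|].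
  apply continuous_Cmult; [apply continuous_Cconst|].
  apply continuous_Cminus; [apply he; exact ht|apply continuous_Cconst]. }
apply (Cmod_is_CRInt_le
  (fun t => g (e t) * de t - (g0 + g1 * (e t - z0)) * de t)%C); [exact hab| |].
- intros t ht.
  replace (g (e t) * de t - (g0 + g1 * (e t - z0)) * de t)%C
    with ((g (e t) - (g0 + g1 * (e t - z0))) * de t)%C by Cring.
  rewrite Cmod_mult; apply Rmult_le_compat; auto using Cmod_ge_0.
- apply is_CRInt_minus.
  + apply CRInt_correct; [exact hab|]; intros t ht; apply continuous_Cmult; auto.
  + apply (is_CRInt_derive (fun t => H (e t))); [exact hab| |exact hca].
    intros t ht; specialize (hd t ht); unfold H.
    assert (hm : is_CRderive (fun t => e t + (- z0))%C t (de t)).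
    { replace (de t) with (de t + 0)%C by Cring.
      apply is_CRderive_plus; [exact hd|apply is_CRderive_const]. }
    (* The integrand is put in the literal shape in which the product rule delivers the derivative
       of [H (e t)]; the zeros are derivatives of constant factors. *)
    replace ((g0 + g1 * (e t - z0)) * de t)%C with
      ((0 * e t + g0 * de t) +
       ((0 * ((e t + - z0) * (e t + - z0)) +
         g1 * (de t * (e t + - z0) + (e t + - z0) * de t)) * / 2 +
        (g1 * ((e t + - z0) * (e t + - z0))) * 0))%C
      by (Cfield; intros h; inversion h; lra).
    apply is_CRderive_plus.
    * apply is_CRderive_mult; [apply is_CRderive_const|exact hd].
    * apply (is_CRderive_mult
        (fun t => g1 * ((e t + - z0) * (e t + - z0)))%C (fun _ => / 2)%C);
        [|apply is_CRderive_const].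
      apply (is_CRderive_mult (fun _ => g1)
        (fun t => (e t + - z0) * (e t + - z0))%C); [apply is_CRderive_const|].
      apply is_CRderive_mult; exact hm.
Qed.

(** * Goursat's theorem for the image of a rectangle under a homotopy *)

Section Homotopy.
Variables (g : C -> C) (E Es Et : R -> R -> C) (q0 : rect) (K : R).
Hypothesis hS : rl q0 <= rr q0.
Hypothesis hT : rb q0 <= rt q0.
Hypothesis hEs : forall s t, is_CRderive (fun s => E s t) s (Es s t).
Hypothesis hEt : forall s t, is_CRderive (fun t => E s t) t (Et s t).
Hypothesis hcs : forall s t, continuous (fun s => Es s t) s.
Hypothesis hct : forall s t, continuous (fun t => Et s t) t.
Hypothesis hKs : forall s t, rl q0 <= s <= rr q0 -> rb q0 <= t <= rt q0 ->
  Cmod (Es s t) <= K.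
Hypothesis hKt : forall s t, rl q0 <= s <= rr q0 -> rb q0 <= t <= rt q0 ->
  Cmod (Et s t) <= K.
Hypothesis hg : forall s t, rl q0 <= s <= rr q0 -> rb q0 <= t <= rt q0 ->
  Cdifferentiable g (E s t).

Definition sInt (t a b : R) : C := CRInt (fun s => g (E s t) * Es s t)%C a b.
Definition tInt (s c d : R) : C := CRInt (fun t => g (E s t) * Et s t)%C c d.

(** The sides are oriented counterclockwise, so that a side shared by two adjacent rectangles
    cancels in the sum. *)
Definition boundary_integral (q : rect) : C :=
  (sInt (rb q) (rl q) (rr q) + tInt (rr q) (rb q) (rt q)
   - sInt (rt q) (rl q) (rr q) - tInt (rl q) (rb q) (rt q))%C.

Lemma sInt_Chasles t a b c :
  rb q0 <= t <= rt q0 -> rl q0 <= a -> a <= b -> b <= c -> c <= rr q0 ->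
  (sInt t a c = sInt t a b + sInt t b c)%C.
Proof.
intros ht ha hab hbc hc; apply CRInt_Chasles; auto.
intros s hs; apply continuous_Cmult; [|apply hcs].
apply (continuous_comp (fun s => E s t) g).
- apply (is_CRderive_continuous _ _ _ (hEs s t)).
- apply Cdifferentiable_continuous, hg; lra.
Qed.

Lemma tInt_Chasles s a b c :
  rl q0 <= s <= rr q0 -> rb q0 <= a -> a <= b -> b <= c -> c <= rt q0 ->
  (tInt s a c = tInt s a b + tInt s b c)%C.
Proof.
intros hs ha hab hbc hc; apply CRInt_Chasles; auto.
intros t ht; apply continuous_Cmult; [|apply hct].
apply (continuous_comp (fun t => E s t) g).
- apply (is_CRderive_continuous _ _ _ (hEt s t)).
- apply Cdifferentiable_continuous, hg; lra.
Qed.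

(** Moving in [s] and then in [t], each leg is controlled by the bound [K] on the speed. This makes
    the image of a small rectangle small. *)
Lemma homotopy_lipschitz s t s' t' :
  rl q0 <= s <= rr q0 -> rb q0 <= t <= rt q0 ->
  rl q0 <= s' <= rr q0 -> rb q0 <= t' <= rt q0 ->
  Cmod (E s t - E s' t') <= K * (Rabs (s - s') + Rabs (t - t')).
Proof.
intros hs ht hs' ht'.
assert (h1 : Cmod (E s t - E s' t) <= K * Rabs (s - s')).
{ destruct (Rle_dec s' s).
  - rewrite Rabs_pos_eq, Rmult_comm by lra.
    apply (Cmod_increment_le (fun s => E s t) (fun s => Es s t)); auto.
    intros u hu; apply hKs; lra.
  - rewrite Rabs_minus_sym, Rabs_pos_eq, Rmult_comm by lra.
    rewrite <- Cmod_opp; replace (- (E s t - E s' t))%C with (E s' t - E s t)%C by Cring.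
    apply (Cmod_increment_le (fun s => E s t) (fun s => Es s t)); auto; try lra.
    intros u hu; apply hKs; lra. }
assert (h2 : Cmod (E s' t - E s' t') <= K * Rabs (t - t')).
{ destruct (Rle_dec t' t).
  - rewrite Rabs_pos_eq, Rmult_comm by lra.
    apply (Cmod_increment_le (fun t => E s' t) (fun t => Et s' t)); auto.
    intros u hu; apply hKt; lra.
  - rewrite Rabs_minus_sym, Rabs_pos_eq, Rmult_comm by lra.
    rewrite <- Cmod_opp; replace (- (E s' t - E s' t'))%C with (E s' t' - E s' t)%C by Cring.
    apply (Cmod_increment_le (fun t => E s' t) (fun t => Et s' t)); auto; try lra.
    intros u hu; apply hKt; lra. }
replace (E s t - E s' t')%C with ((E s t - E s' t) + (E s' t - E s' t'))%C by Cring.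
eapply Rle_trans; [apply Cmod_triangle|]; lra.
Qed.

(* Goursat's argument, carried out in the parameter rectangle of the homotopy. *)
Lemma boundary_integral_0 : boundary_integral q0 = 0.
Proof.
apply Cmod_eq_0, Rle_antisym; [|apply Cmod_ge_0].
assert (hK0 : 0 <= K).
{ eapply Rle_trans; [apply Cmod_ge_0|]; apply (hKs (rl q0) (rb q0)); lra. }
apply (bisection_nonpos (fun q => Cmod (boundary_integral q))); auto.
- intros q [q1 [q2 [q3 [q4 [q5 q6]]]]]; unfold quarters.
  set (m := (rl q + rr q) / 2); set (n := (rb q + rt q) / 2).
  assert (rl q <= m <= rr q) by (unfold m; lra).
  assert (rb q <= n <= rt q) by (unfold n; lra).
  assert (e : boundary_integral q =
    (boundary_integral (mkRect (rl q) m (rb q) n) +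
     boundary_integral (mkRect m (rr q) (rb q) n) +
     boundary_integral (mkRect (rl q) m n (rt q)) +
     boundary_integral (mkRect m (rr q) n (rt q)))%C).
  { unfold boundary_integral; simpl.
    rewrite (sInt_Chasles (rb q) (rl q) m (rr q)) by lra.
    rewrite (sInt_Chasles (rt q) (rl q) m (rr q)) by lra.
    rewrite (tInt_Chasles (rl q) (rb q) n (rt q)) by lra.
    rewrite (tInt_Chasles (rr q) (rb q) n (rt q)) by lra.
    Cring. }
  rewrite e.
  repeat (eapply Rle_trans; [apply Cmod_triangle|]; apply Rplus_le_compat_r).
  apply Rle_refl.
- intros x y hx hy eps heps.
  destruct (hg x y hx hy) as [phi [hc he]].
  (* The final estimate is [2 eps' K^2 S^2], with [S] the half-perimeter; the [+ 1] covers
     [K = 0]. *)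
  set (eps' := eps / (4 * (K * K + 1))).
  assert (heps' : 0 < eps') by (apply Rdiv_lt_0_compat; nra).
  rewrite continuous_Cmod in hc; specialize (hc eps' heps').
  generalize (filter_and _ _ hc he); clear hc he; intros h.
  apply locally_Cmod in h; destruct h as [eta [heta h]].
  (* Sides this short give [K S < eta], so the image of the whole rectangle lies where the affine
     approximation of [g] at [E x y] is good. *)
  exists (eta / (4 * (K + 1))); split; [apply Rdiv_lt_0_compat; lra|].
  intros q [q1 [q2 [q3 [q4 [q5 q6]]]]] hxq hyq hw hh.
  set (S := (rr q - rl q) + (rt q - rb q)).
  assert (hS0 : 0 <= S) by (unfold S; lra).
  assert (hSeta : K * S < eta).
  { assert (hlt : S < eta / (2 * (K + 1))).
    { unfold S; replace (eta / (2 * (K + 1))) with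
        (eta / (4 * (K + 1)) + eta / (4 * (K + 1))) by (field; lra); lra. }
    apply (Rmult_lt_compat_r (2 * (K + 1))) in hlt; [|lra].
    replace (eta / (2 * (K + 1)) * (2 * (K + 1))) with eta in hlt by (field; lra).
    nra. }
  set (M := eps' * (K * S)).
  assert (hM : 0 <= M) by (unfold M; apply Rmult_le_pos; nra).
  assert (hdev : forall s t, rl q <= s <= rr q -> rb q <= t <= rt q ->
    Cmod (g (E s t) - (g (E x y) + phi (E x y) * (E s t - E x y))) <= M).
  { intros s t hs ht.
    assert (hl : Cmod (E s t - E x y) <= K * S).
    { eapply Rle_trans; [apply homotopy_lipschitz; lra|].
      apply Rmult_le_compat_l; [exact hK0|].
      unfold S; apply Rplus_le_compat; apply Rabs_le; lra. }
    destruct (h (E s t)) as [h1 h2]; [lra|].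
    replace (g (E s t) - (g (E x y) + phi (E x y) * (E s t - E x y)))%C
      with ((g (E s t) - g (E x y)) - phi (E x y) * (E s t - E x y))%C by Cring.
    rewrite h2.
    replace (phi (E s t) * (E s t - E x y) - phi (E x y) * (E s t - E x y))%C
      with ((phi (E s t) - phi (E x y)) * (E s t - E x y))%C by Cring.
    rewrite Cmod_mult; apply Rmult_le_compat; auto using Cmod_ge_0; lra. }
  set (H := fun z => (g (E x y) * z + phi (E x y) *
    ((z - E x y) * (z - E x y)) / 2)%C).
  assert (hs : forall t, rb q <= t <= rt q ->
    Cmod (sInt t (rl q) (rr q) - (H (E (rr q) t) - H (E (rl q) t)))
      <= (rr q - rl q) * (M * K)).
  { intros t ht; apply (path_integral_affine_le g (fun s => E s t)
      (fun s => Es s t)); auto.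
    - intros s hs; apply Cdifferentiable_continuous, hg; lra.
    - intros s hs; apply hKs; lra. }
  assert (ht : forall s, rl q <= s <= rr q ->
    Cmod (tInt s (rb q) (rt q) - (H (E s (rt q)) - H (E s (rb q))))
      <= (rt q - rb q) * (M * K)).
  { intros s hs'; apply (path_integral_affine_le g (fun t => E s t)
      (fun t => Et s t)); auto.
    - intros t ht; apply Cdifferentiable_continuous, hg; lra.
    - intros t ht; apply hKt; lra. }
  assert (hb := hs (rb q) ltac:(lra)); assert (ht' := hs (rt q) ltac:(lra)).
  assert (hl := ht (rl q) ltac:(lra)); assert (hr := ht (rr q) ltac:(lra)).
  (* The increments of the primitive [H] cancel around the four corners, so the boundary integral is
     the signed sum of the four deviations [A], [B], [A'], [B']. *)
  set (A := (sInt (rb q) (rl q) (rr q)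
    - (H (E (rr q) (rb q)) - H (E (rl q) (rb q))))%C) in *.
  set (B := (tInt (rr q) (rb q) (rt q)
    - (H (E (rr q) (rt q)) - H (E (rr q) (rb q))))%C) in *.
  set (A' := (sInt (rt q) (rl q) (rr q)
    - (H (E (rr q) (rt q)) - H (E (rl q) (rt q))))%C) in *.
  set (B' := (tInt (rl q) (rb q) (rt q)
    - (H (E (rl q) (rt q)) - H (E (rl q) (rb q))))%C) in *.
  replace (boundary_integral q) with (A + B + - A' + - B')%C
    by (unfold boundary_integral, A, B, A', B'; Cring).
  apply Rle_trans with (Cmod A + Cmod B + Cmod A' + Cmod B').
  { rewrite <- (Cmod_opp A'), <- (Cmod_opp B').
    repeat (eapply Rle_trans; [apply Cmod_triangle|]; apply Rplus_le_compat_r).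
    apply Rle_refl. }
  apply Rle_trans with (2 * S * (M * K)).
  { unfold S; lra. }
  unfold M.
  replace (2 * S * (eps' * (K * S) * K)) with (eps' * (2 * (K * K)) * S ^ 2) by ring.
  apply Rmult_le_compat_r; [nra|].
  apply Rle_trans with (eps' * (4 * (K * K + 1))); [|right; unfold eps'; field; nra].
  apply Rmult_le_compat_l; nra.
Qed.

End Homotopy.

(** * Cauchy's formula and isolation of zeros *)

Definition cis (t : R) : C := (cos t, sin t).

Lemma Cmod_cis t : Cmod (cis t) = 1.
Proof.
unfold Cmod, cis; simpl fst; simpl snd.
replace (cos t ^ 2 + sin t ^ 2) with 1; [apply sqrt_1|].
rewrite <- (sin2_cos2 t); unfold Rsqr; ring.
Qed.

Lemma cis_neq_0 t : cis t <> 0.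
Proof. apply Cmod_gt_0; rewrite Cmod_cis; lra. Qed.

Lemma is_CRderive_cis t : is_CRderive cis t (Ci * cis t)%C.
Proof.
apply is_CRderive_pair; unfold cis; simpl; split; auto_derive; trivial; ring.
Qed.

Lemma is_CRderive_RtoC t : is_CRderive RtoC t (RtoC 1).
Proof. apply is_CRderive_pair; simpl; split; auto_derive; trivial. Qed.

Lemma continuous_cis t : continuous cis t.
Proof. exact (is_CRderive_continuous _ _ _ (is_CRderive_cis t)). Qed.

Lemma Cmod_RtoC_pos r : 0 <= r -> Cmod (RtoC r) = r.
Proof. intros h; rewrite Cmod_R; apply Rabs_pos_eq, h. Qed.

Lemma Cmod_minus_ge (a b : C) : Cmod a - Cmod b <= Cmod (a - b).
Proof.
replace a with ((a - b) + b)%C at 1 by Cring.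
pose proof (Cmod_triangle (a - b) b); lra.
Qed.

Section Disk.
Variables (f : C -> C) (r : R).
Hypothesis hr : 0 < r.
Hypothesis hf : forall z, Cmod z <= r -> Cdifferentiable f z.

Definition circ (t : R) : C := (RtoC r * cis t)%C.

Lemma Cmod_circ t : Cmod (circ t) = r.
Proof. unfold circ; rewrite Cmod_mult, Cmod_cis, Cmod_RtoC_pos; lra. Qed.

Lemma circ_neq_0 t : circ t <> 0.
Proof. apply Cmod_gt_0; rewrite Cmod_circ; lra. Qed.

Lemma circ_minus_neq_0 t w : Cmod w < r -> (circ t - w)%C <> 0.
Proof.
intros hw; apply Cmod_gt_0.
pose proof (Cmod_minus_ge (circ t) w); rewrite Cmod_circ in *; lra.
Qed.

Lemma continuous_circ t : continuous circ t.
Proof. apply continuous_Cmult; [apply continuous_Cconst|apply continuous_cis]. Qed.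

Lemma continuous_f_circ t : continuous (fun t => f (circ t)) t.
Proof.
apply (continuous_comp circ f); [apply continuous_circ|].
apply Cdifferentiable_continuous, hf; rewrite Cmod_circ; lra.
Qed.

(* The affine homotopy from the circle of radius [rho] about [w] to the circle
   of radius [r] about the origin avoids [w]. *)
Lemma Cauchy_circles (w : C) (rho : R) :
  0 < rho -> rho + Cmod w < r ->
  CRInt (fun t => f (circ t) * / (circ t - w) * (Ci * circ t))%C 0 (2 * PI) =
  CRInt (fun t => Ci * f (w + RtoC rho * cis t))%C 0 (2 * PI).
Proof.
intros hrho hw.
assert (hw0 := Cmod_ge_0 w); assert (hpi := PI_RGT_0).
set (g := fun z => (f z * / (z - w))%C).
set (E := fun s t : R => (w + RtoC rho * cis t
  + RtoC s * (RtoC (r - rho) * cis t - w))%C).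
set (Es := fun s t : R => (RtoC (r - rho) * cis t - w)%C).
set (Et := fun s t : R => (RtoC (rho + s * (r - rho)) * (Ci * cis t))%C).
(* Stage [s] is the circle of centre [(1 - s) w] and radius [rho + s (r - rho)]. Its distance to [w]
   is at least [rho + s (r - rho - |w|) >= rho], and it stays in the disk of radius [r]. *)
assert (hEeq : forall s t, E s t =
  ((RtoC 1 - RtoC s) * w + RtoC (rho + s * (r - rho)) * cis t)%C).
{ intros s t; unfold E; rewrite RtoC_plus, RtoC_mult, RtoC_minus; Cring. }
assert (h0 : boundary_integral g E Es Et (mkRect 0 1 0 (2 * PI)) = 0).
(* The speed bound [2 r] holds since [|Es| <= (r - rho) + |w| < 2 r] and [|Et| <= r]. *)
{ apply (boundary_integral_0 g E Es Et _ (2 * r)); simpl.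
  - lra.
  - lra.
  - intros s t; unfold E, Es.
    refine (eq_ind (0 + (1 * (RtoC (r - rho) * cis t - w) + RtoC s * 0))%C
      (fun l => is_CRderive _ s l) _ _ _); [|Cring].
    apply is_CRderive_plus; [apply is_CRderive_const|].
    apply (is_CRderive_mult RtoC (fun _ => (RtoC (r - rho) * cis t - w)%C));
      [apply is_CRderive_RtoC|apply is_CRderive_const].
  - intros s t.
    apply (is_derive_ext (V := C_R_NormedModule) (fun t =>
      ((RtoC 1 - RtoC s) * w + RtoC (rho + s * (r - rho)) * cis t)%C));
      [intros; symmetry; apply hEeq|].
    unfold Et.
    refine (eq_ind (0 + (0 * cis t + RtoC (rho + s * (r - rho)) * (Ci * cis t)))%C
      (fun l => is_CRderive _ t l) _ _ _); [|Cring].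
    apply (is_CRderive_plus (fun _ => ((RtoC 1 - RtoC s) * w)%C)); [apply is_CRderive_const|].
    apply (is_CRderive_mult (fun _ => RtoC (rho + s * (r - rho))) cis);
      [apply is_CRderive_const|apply is_CRderive_cis].
  - intros s t; apply continuous_Cconst.
  - intros s t; apply continuous_Cmult; [apply continuous_Cconst|].
    apply continuous_Cmult; [apply continuous_Cconst|apply continuous_cis].
  - intros s t hs ht; unfold Es, Cminus.
    eapply Rle_trans; [apply Cmod_triangle|].
    rewrite Cmod_opp, Cmod_mult, Cmod_cis, Cmod_RtoC_pos; lra.
  - intros s t hs ht; unfold Et.
    rewrite !Cmod_mult, Cmod_cis, Cmod_Ci, Cmod_RtoC_pos; nra.
  - intros s t hs ht.
    assert (hc : 0 <= rho + s * (r - rho)) by nra.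
    apply (Cdifferentiable_mult f (fun z => / (z - w))%C).
    + apply hf; rewrite hEeq; eapply Rle_trans; [apply Cmod_triangle|].
      rewrite !Cmod_mult, Cmod_cis, <- RtoC_minus, !Cmod_RtoC_pos by lra; nra.
    + apply Cdifferentiable_inv_minus; intros e.
      assert (he : (RtoC (rho + s * (r - rho)) * cis t - RtoC s * w)%C = 0).
      { replace (RtoC 0) with (E s t - w)%C by (rewrite e; Cring).
        rewrite hEeq; Cring. }
      pose proof (Cmod_minus_ge (RtoC (rho + s * (r - rho)) * cis t) (RtoC s * w)) as h.
      rewrite he, Cmod_0, !Cmod_mult, Cmod_cis, !Cmod_RtoC_pos in h by lra; nra. }
unfold boundary_integral in h0; simpl in h0.
(* The sides [t = 0] and [t = 2 PI] trace the same path and cancel; what remains equates the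
   integrals over the initial and the final circle. *)
assert (hper : cis (2 * PI) = cis 0)
  by (unfold cis; rewrite cos_2PI, sin_2PI, cos_0, sin_0; reflexivity).
replace (sInt g E Es (2 * PI) 0 1) with (sInt g E Es 0 0 1) in h0
  by (unfold sInt, E, Es; rewrite hper; reflexivity).
assert (h1 : tInt g E Et 1 0 (2 * PI) = tInt g E Et 0 0 (2 * PI)).
{ replace (tInt g E Et 1 0 (2 * PI)) with (tInt g E Et 0 0 (2 * PI) +
    (sInt g E Es 0 0 1 + tInt g E Et 1 0 (2 * PI) - sInt g E Es 0 0 1
     - tInt g E Et 0 0 (2 * PI)))%C by Cring.
  rewrite h0; Cring. }
unfold tInt in h1.
rewrite (RInt_ext (V := C_R_CompleteNormedModule)
  _ (fun t => g (E 1 t) * Et 1 t)%C).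
(* At [s = 0] the denominator [rho cis t] cancels against the velocity and leaves the factor
   [Ci]. *)
- rewrite h1; apply (RInt_ext (V := C_R_CompleteNormedModule)); intros t _.
  unfold g, Et; rewrite hEeq.
  replace (rho + 0 * (r - rho)) with rho by ring.
  replace ((1 - 0) * w + RtoC rho * cis t)%C with (w + RtoC rho * cis t)%C by Cring.
  replace (w + RtoC rho * cis t - w)%C with (RtoC rho * cis t)%C by Cring.
  Cfield; split; [apply cis_neq_0|].
  intros e; apply RtoC_inj in e; lra.
- intros t _; unfold g, Et; rewrite hEeq.
  replace (rho + 1 * (r - rho)) with r by ring.
  replace ((1 - 1) * w + RtoC r * cis t)%C with (circ t)%C by (unfold circ; Cring).
  unfold circ; Cring.
Qed.

(** With [d zeta = Ci zeta dt], this is the integral of [f(zeta) zeta^-n / (zeta - w)] over the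
    circle, divided by [Ci]. At [w = 0] it is [2 PI] times the [n]-th Taylor coefficient of [f];
    elsewhere it is [2 PI] times the [n]-th Taylor remainder divided by [w^n]. *)
Definition cauchy_transform (n : nat) (w : C) : C :=
  CRInt (fun t => f (circ t) * (/ circ t) ^ n * (circ t * / (circ t - w)))%C 0 (2 * PI).

Lemma continuous_cauchy_integrand n w t : Cmod w < r ->
  continuous (fun t => f (circ t) * (/ circ t) ^ n * (circ t * / (circ t - w)))%C t.
Proof.
intros hw; apply continuous_Cmult; [apply continuous_Cmult|apply continuous_Cmult].
- apply continuous_f_circ.
- induction n as [|n IH]; [apply continuous_Cconst|].
  apply continuous_Cmult; [|exact IH].
  apply continuous_Cinv; [apply circ_neq_0|apply continuous_circ].
- apply continuous_circ.
- apply continuous_Cinv; [apply circ_minus_neq_0, hw|].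
  apply continuous_Cminus; [apply continuous_circ|apply continuous_Cconst].
Qed.

Lemma is_CRInt_cauchy n w : Cmod w < r ->
  is_CRInt (fun t => f (circ t) * (/ circ t) ^ n * (circ t * / (circ t - w)))%C
    0 (2 * PI) (cauchy_transform n w).
Proof.
intros hw; assert (hpi := PI_RGT_0); apply CRInt_correct; [lra|].
intros t _; apply continuous_cauchy_integrand, hw.
Qed.

(** By [Cauchy_circles] the integral of [f] over a circle of radius [rho] about [w] does not depend
    on [rho]; letting [rho] shrink, continuity at [w] identifies its value. *)
Lemma Cauchy_formula (w : C) : Cmod w < r ->
  cauchy_transform 0 w = (RtoC (2 * PI) * f w)%C.
Proof.
intros hw; assert (hpi := PI_RGT_0).
assert (hCi : Ci <> 0) by (intros e; inversion e; lra).
assert (hrho : forall rho, 0 < rho -> rho + Cmod w < r ->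
  is_CRInt (fun t => f (w + RtoC rho * cis t))%C 0 (2 * PI) (cauchy_transform 0 w)).
{ intros rho h1 h2.
  assert (hc : forall t, continuous (fun t => f (w + RtoC rho * cis t))%C t).
  { intros t; apply (continuous_comp (fun t => w + RtoC rho * cis t)%C f).
    - apply continuous_Cplus; [apply continuous_Cconst|].
      apply continuous_Cmult; [apply continuous_Cconst|apply continuous_cis].
    - apply Cdifferentiable_continuous, hf.
      eapply Rle_trans; [apply Cmod_triangle|].
      rewrite Cmod_mult, Cmod_cis, Cmod_RtoC_pos; lra. }
  assert (hi := CRInt_correct _ 0 (2 * PI) ltac:(lra) (fun t _ => hc t)).
  replace (cauchy_transform 0 w) with
    (CRInt (fun t => f (w + RtoC rho * cis t))%C 0 (2 * PI)); [exact hi|].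
  assert (e : (Ci * CRInt (fun t => f (w + RtoC rho * cis t)) 0 (2 * PI)
    = Ci * cauchy_transform 0 w)%C).
  { etransitivity; [symmetry; exact (is_CRInt_unique _ _ _ _ (is_CRInt_mult Ci _ _ _ _ hi))|].
    etransitivity; [symmetry; exact (Cauchy_circles w rho h1 h2)|].
    apply is_CRInt_unique.
    apply (is_RInt_ext (V := C_R_NormedModule) (fun t => Ci *
      (f (circ t) * (/ circ t) ^ 0 * (circ t * / (circ t - w))))%C).
    - intros t _; simpl; Cring.
    - apply is_CRInt_mult, is_CRInt_cauchy, hw. }
  apply (f_equal (fun z => / Ci * z)%C) in e.
  rewrite !Cmult_assoc, Cinv_l, !Cmult_1_l in e by exact hCi; exact e. }
assert (hcw : continuous f w) by (apply Cdifferentiable_continuous, hf; lra).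
rewrite continuous_Cmod in hcw.
replace (cauchy_transform 0 w) with
  ((cauchy_transform 0 w - RtoC (2 * PI) * f w) + RtoC (2 * PI) * f w)%C by Cring.
replace (cauchy_transform 0 w - RtoC (2 * PI) * f w)%C with (RtoC 0); [Cring|].
symmetry; apply Cmod_eq_0.
apply Rle_antisym; [|apply Cmod_ge_0]; apply le_epsilon; intros eps heps.
destruct (proj1 (locally_Cmod _ _) (hcw (eps / (2 * PI)) ltac:(apply Rdiv_lt_0_compat; lra)))
  as [d [hd h]].
set (rho := Rmin (d / 2) ((r - Cmod w) / 2)).
assert (hrho0 : 0 < rho) by (apply Rmin_glb_lt; lra).
assert (rho <= d / 2) by apply Rmin_l.
assert (rho <= (r - Cmod w) / 2) by apply Rmin_r.
replace (0 + eps) with ((2 * PI - 0) * (eps / (2 * PI))) by (field; lra).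
apply (Cmod_is_CRInt_le (fun t => f (w + RtoC rho * cis t) - f w)%C); [lra| |].
- intros t _; left; apply h.
  replace (w + RtoC rho * cis t - w)%C with (RtoC rho * cis t)%C by Cring.
  rewrite Cmod_mult, Cmod_cis, Cmod_RtoC_pos; lra.
- apply is_CRInt_minus; [apply hrho; lra|].
  replace (RtoC (2 * PI) * f w)%C with (scal (V := C_R_NormedModule) (2 * PI - 0) (f w)).
  + apply (is_RInt_const (V := C_R_NormedModule)).
  + rewrite Rminus_0_r; unfold scal; simpl.
    apply injective_projections; simpl; unfold scal; simpl; unfold mult; simpl; ring.
Qed.

(* The geometric series, one term at a time. *)
Lemma cauchy_transform_S n w : Cmod w < r ->
  (cauchy_transform n w = cauchy_transform n 0 + w * cauchy_transform (S n) w)%C.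
Proof.
intros hw; apply is_CRInt_unique.
apply (is_RInt_ext (V := C_R_NormedModule) (fun t =>
  f (circ t) * (/ circ t) ^ n * (circ t * / (circ t - 0)) +
  w * (f (circ t) * (/ circ t) ^ (S n) * (circ t * / (circ t - w))))%C).
- intros t _; simpl Cpow.
  assert (h1 := circ_neq_0 t); assert (h2 := circ_minus_neq_0 t w hw).
  Cfield; split; assumption.
- apply is_CRInt_plus; [|apply is_CRInt_mult]; apply is_CRInt_cauchy; auto.
  rewrite Cmod_0; lra.
Qed.

(** On the circle [|f|] has a maximum [B], and [|zeta / (zeta - w)| <= r / (r / 2) = 2]; the
    interval of integration contributes [2 PI]. *)
Lemma cauchy_transform_bound : exists M, 0 <= M /\ forall n w, Cmod w <= r / 2 ->
  Cmod (cauchy_transform n w) <= M * (/ r) ^ n.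
Proof.
assert (hpi := PI_RGT_0).
destruct (continuity_ab_maj (fun t => Cmod (f (circ t))) 0 (2 * PI)) as [m [hm _]].
{ lra. }
{ intros t _; apply continuity_pt_filterlim.
  apply (continuous_comp (fun t => f (circ t)) Cmod); [apply continuous_f_circ|].
  apply (continuous_ext (fun z : C => norm (K := R_AbsRing) (V := C_R_NormedModule) z)).
  - intros z; symmetry; apply Cmod_norm.
  - apply (filterlim_norm (V := C_R_NormedModule)). }
set (B := Cmod (f (circ m))) in *.
assert (hB : 0 <= B) by apply Cmod_ge_0.
exists (2 * PI * (B * 2)); split; [nra|].
intros n w hw.
assert (hp : 0 < (/ r) ^ n) by (apply pow_lt, Rinv_0_lt_compat, hr).
replace (2 * PI * (B * 2) * (/ r) ^ n)
  with ((2 * PI - 0) * (B * (/ r) ^ n * 2)) by ring.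
refine (Cmod_is_CRInt_le _ _ _ _ _ _ _ (is_CRInt_cauchy n w _)); [lra| |lra].
intros t ht; rewrite !Cmod_mult, Cmod_pow, Cmod_inv, !Cmod_circ
  by auto using circ_neq_0.
assert (hk : r * Cmod (/ (circ t - w)) <= 2).
{ rewrite Cmod_inv by (apply circ_minus_neq_0; lra).
  pose proof (Cmod_minus_ge (circ t) w); rewrite Cmod_circ in *.
  apply (Rmult_le_reg_r (Cmod (circ t - w))); [lra|].
  rewrite Rmult_assoc, Rinv_l by lra; lra. }
assert (0 <= Cmod (/ (circ t - w))) by apply Cmod_ge_0.
apply Rmult_le_compat; try nra.
- apply Rmult_le_pos; [apply Cmod_ge_0|lra].
- apply Rmult_le_compat_r; [lra|apply hm; exact ht].
Qed.

(** Let [m] be the order of the first nonzero Taylor coefficient: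
    [2 PI f(w) = w^m cauchy_transform m w], and the second factor is nonzero near the origin. If all
    coefficients vanish, [2 PI |f(z)| <= M (|z| / r)^N <= M 2^-N] for every [N], so [f] vanishes on
    the half-size disk. *)
Lemma isolated_zero_0 :
  locally (0 : C) (fun z => f z = 0) \/ locally' (0 : C) (fun z => f z <> 0).
Proof.
assert (hpi := PI_RGT_0).
destruct cauchy_transform_bound as [M [hM hb]].
assert (h2pi : RtoC (2 * PI) <> 0) by (intros e; apply RtoC_inj in e; lra).
assert (hfac : forall n w, Cmod w < r ->
  (forall k, (k < n)%nat -> cauchy_transform k 0 = 0) ->
  (RtoC (2 * PI) * f w = w ^ n * cauchy_transform n w)%C).
{ intros n w hw; induction n as [|n IH]; intros hk.
  - rewrite <- Cauchy_formula by exact hw; simpl; Cring.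
  - rewrite IH by (intros k hkn; apply hk; lia).
    rewrite (cauchy_transform_S n w hw), (hk n) by lia; simpl; Cring. }
destruct (Classical_Prop.classic (exists n, cauchy_transform n 0 <> 0)) as [hex|hnex].
- right.
  destruct (Wf_nat.dec_inh_nat_subset_has_unique_least_element
    (fun n => cauchy_transform n 0 <> 0)) as [m [[hm hleast] _]].
  { intros n; destruct (Ceq_dec (cauchy_transform n 0) 0); auto. }
  { exact hex. }
  assert (hlow : forall k, (k < m)%nat -> cauchy_transform k 0 = 0).
  { intros k hk; destruct (Ceq_dec (cauchy_transform k 0) 0) as [e|n]; [exact e|].
    specialize (hleast k n); lia. }
  assert (ha : 0 < Cmod (cauchy_transform m 0)) by (apply Cmod_gt_0, hm).
  set (a := Cmod (cauchy_transform m 0)) in *.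
  set (B := M * (/ r) ^ S m).
  assert (hB : 0 <= B).
  { apply Rmult_le_pos; [exact hM|left; apply pow_lt, Rinv_0_lt_compat, hr]. }
  (* Within [a / (B + 1)] the correction [z cauchy_transform (S m) z] is smaller in modulus than the
     leading value [a]. *)
  apply locally'_Cmod; exists (Rmin (r / 2) (a / (B + 1))); split.
  { apply Rmin_glb_lt; [lra|apply Rdiv_lt_0_compat; lra]. }
  intros z hz0 hz; replace (z - 0)%C with z in hz by Cring.
  assert (hz1 : Cmod z < r / 2) by (eapply Rlt_le_trans; [exact hz|apply Rmin_l]).
  assert (hz2 : Cmod z < a / (B + 1)) by (eapply Rlt_le_trans; [exact hz|apply Rmin_r]).
  assert (hz3 : Cmod z * B < a).
  { apply (Rmult_lt_compat_r (B + 1)) in hz2; [|lra].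
    unfold Rdiv in hz2; rewrite Rmult_assoc, Rinv_l in hz2 by lra.
    pose proof (Cmod_ge_0 z); nra. }
  intros e.
  assert (hzero : (z ^ m * cauchy_transform m z)%C = 0).
  { rewrite <- hfac, e by (auto; lra); Cring. }
  assert (hnz : cauchy_transform m z <> 0).
  { apply Cmod_gt_0.
    rewrite cauchy_transform_S by lra.
    pose proof (Cmod_minus_ge (cauchy_transform m 0)
      (- (z * cauchy_transform (S m) z))) as h.
    replace (cauchy_transform m 0 - - (z * cauchy_transform (S m) z))%C
      with (cauchy_transform m 0 + z * cauchy_transform (S m) z)%C in h by Cring.
    rewrite Cmod_opp, Cmod_mult in h.
    assert (Cmod z * Cmod (cauchy_transform (S m) z) <= Cmod z * B).
    { apply Rmult_le_compat_l; [apply Cmod_ge_0|]; apply hb; lra. }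
    fold a in h; lra. }
  revert hzero; apply Cmult_neq_0; [apply Cpow_nz; exact hz0|exact hnz].
- left; apply locally_Cmod; exists (r / 2); split; [lra|].
  intros z hz; replace (z - 0)%C with z in hz by Cring.
  assert (hn : forall n, cauchy_transform n 0 = 0).
  { intros n; destruct (Ceq_dec (cauchy_transform n 0) 0) as [e|h]; [exact e|].
    exfalso; apply hnex; exists n; exact h. }
  assert (hz0 : (RtoC (2 * PI) * f z)%C = 0).
  { apply Cmod_eq_0, Rle_antisym; [|apply Cmod_ge_0].
    apply le_epsilon; intros eps heps; rewrite Rplus_0_l.
    destruct (pow_lt_1_zero (/ 2)) with (y := eps / (M + 1)) as [N hN].
    { rewrite Rabs_pos_eq; lra. }
    { apply Rdiv_lt_0_compat; lra. }
    specialize (hN N (le_n N)).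
    rewrite Rabs_pos_eq in hN by (apply pow_le; lra).
    rewrite (hfac N z) by (auto; lra).
    rewrite Cmod_mult, Cmod_pow.
    assert (hpz : 0 <= Cmod z ^ N) by (apply pow_le, Cmod_ge_0).
    apply Rle_trans with (Cmod z ^ N * (M * (/ r) ^ N)).
    { apply Rmult_le_compat_l; [exact hpz|]; apply hb; lra. }
    replace (Cmod z ^ N * (M * (/ r) ^ N)) with (M * (Cmod z * / r) ^ N)
      by (rewrite Rpow_mult_distr; ring).
    apply Rle_trans with (M * (/ 2) ^ N).
    { apply Rmult_le_compat_l; [exact hM|]; apply pow_incr; split.
      - apply Rmult_le_pos; [apply Cmod_ge_0|left; apply Rinv_0_lt_compat, hr].
      - apply (Rmult_le_reg_r r); [exact hr|].
        rewrite Rmult_assoc, Rinv_l by lra; lra. }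
    apply (Rmult_lt_compat_r (M + 1)) in hN; [|lra].
    unfold Rdiv in hN; rewrite Rmult_assoc, Rinv_l in hN by lra.
    assert (0 <= (/ 2) ^ N) by (apply pow_le; lra).
    nra. }
  destruct (Ceq_dec (f z) 0) as [e|h]; [exact e|].
  exfalso; revert hz0; apply Cmult_neq_0; assumption.
Qed.

End Disk.

Lemma isolated_zero (f : C -> C) (p : C) :
  locally p (Cdifferentiable f) ->
  locally p (fun z => f z = 0) \/ locally' p (fun z => f z <> 0).
Proof.
intros h; apply locally_Cmod in h; destruct h as [d [hd h]].
destruct (isolated_zero_0 (fun z => f (p + z)%C) (d / 2)) as [h0|h0].
- lra.
- intros z hz; apply Cdifferentiable_shift, h.
  replace (p + z - p)%C with z by Cring; lra.
- left; apply locally_Cmod; apply locally_Cmod in h0.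
  destruct h0 as [e [he h0]]; exists e; split; [exact he|].
  intros z hz; replace z with (p + (z - p))%C by Cring; apply h0.
  replace (z - p - 0)%C with (z - p)%C by Cring; exact hz.
- right; apply locally'_Cmod; apply locally'_Cmod in h0.
  destruct h0 as [e [he h0]]; exists e; split; [exact he|].
  intros z hzp hz; replace z with (p + (z - p))%C by Cring; apply h0.
  + apply Cminus_neq_0, hzp.
  + replace (z - p - 0)%C with (z - p)%C by Cring; exact hz.
Qed.

(** * The conjugating function *)

Lemma locally_punctured (p : C) (P : C -> Prop) : locally p P -> locally' p P.
Proof. unfold locally', within; apply filter_imp; auto. Qed.

Lemma Ci_sqr : (Ci * Ci = - RtoC 1)%C.
Proof. apply injective_projections; simpl; ring. Qed.

Lemma HC_eq (a b : HC) :
  h0 a = h0 b -> h1 a = h1 b -> h2 a = h2 b -> h3 a = h3 b -> a = b.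
Proof. destruct a, b; simpl; intros; subst; reflexivity. Qed.

(** Clearing the denominator [chi^s] reduces a conjugation to a polynomial identity, within reach of
    [ring]. *)
Lemma conjugation_by_invertible (F chi : HC) :
  Hs chi <> 0 ->
  Hmul (Hmul chi HL) (Hconj chi) = Hscale (Hs chi) F ->
  F = Hmul (Hmul chi HL) (Hinv chi).
Proof.
intros hs h.
assert (e : Hmul (Hmul chi HL) (Hinv chi)
  = Hscale (/ Hs chi) (Hmul (Hmul chi HL) (Hconj chi))).
{ unfold Hinv; generalize (Hmul chi HL) (Hconj chi) (/ Hs chi)%C.
  intros x y c; unfold Hmul, Hscale; simpl; f_equal; Cring. }
rewrite e, h; apply HC_eq; simpl; Cfield; exact hs.
Qed.

(* Since [F F = L L = 0], [chi = F + L] satisfies [F chi = F L = chi L]. *)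
Definition chi_generic (F : HC) : HC := Hadd F HL.

(** Expanding the quadratic form, [(F + L)^s = F^s + L^s] plus twice the bilinear product of [F] and
    [L]; both squares vanish. *)
Lemma Hs_chi_generic (F : HC) : h0 F = 0 -> Hs F = 0 ->
  Hs (chi_generic F) = (RtoC 2 * (h1 F + Ci * h2 F))%C.
Proof.
intros e0 es.
replace (RtoC 2 * (h1 F + Ci * h2 F))%C
  with (Hs F + RtoC 2 * (h1 F + Ci * h2 F))%C by (rewrite es; Cring).
unfold Hs, chi_generic, Hadd, HL; simpl; rewrite e0.
ring [Ci_sqr].
Qed.

Lemma chi_generic_conj (F : HC) : h0 F = 0 -> Hs F = 0 ->
  Hmul (Hmul (chi_generic F) HL) (Hconj (chi_generic F))
  = Hscale (Hs (chi_generic F)) F.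
Proof.
intros e0 es; rewrite Hs_chi_generic by assumption.
assert (e3 : (h3 F * h3 F = - (h1 F * h1 F) - h2 F * h2 F)%C).
{ replace (h3 F * h3 F)%C with (Hs F - h0 F * h0 F - h1 F * h1 F - h2 F * h2 F)%C
    by (unfold Hs; Cring).
  rewrite es, e0; Cring. }
destruct F as [f0 f1 f2 f3]; simpl in *; subst f0.
apply HC_eq; simpl; ring [Ci_sqr e3].
Qed.

(* A direct choice for [F = phi L], where [F + L] is not invertible. *)
Definition chi_special (phi : C) : HC :=
  mkHC (phi + 1)%C 0 0 (Ci * (phi - 1))%C.

Lemma Hs_chi_special (phi : C) : Hs (chi_special phi) = (RtoC 4 * phi)%C.
Proof. unfold Hs, chi_special; simpl; ring [Ci_sqr]. Qed.

(** Since [k L = - Ci L] and [L k = Ci L], left and right multiplication of [L] by [a + b k] give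
    the multiples [(a - Ci b) L] and [(a + Ci b) L]. For [chi_special phi] these factors are [2 phi]
    and [2], whence [chi L = phi L chi]. *)
Lemma chi_special_conj (phi : C) :
  Hmul (Hmul (chi_special phi) HL) (Hconj (chi_special phi))
  = Hscale (Hs (chi_special phi)) (Hscale phi HL).
Proof. rewrite Hs_chi_special; apply HC_eq; simpl; ring [Ci_sqr]. Qed.

Lemma Cmult_eq_0 (a b : C) : (a * b)%C = 0 -> a = 0 \/ b = 0.
Proof.
intros h; destruct (Ceq_dec a 0) as [|na]; [left; assumption|].
destruct (Ceq_dec b 0) as [|nb]; [right; assumption|].
exfalso; exact (Cmult_neq_0 _ _ na nb h).
Qed.

(** The sum of the squares of the first two components factors through [h1 F + Ci * h2 F], so
    [F^s = 0] leaves [h3 F] with square zero. *)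
Lemma multiple_of_L (F : HC) : h0 F = 0 -> Hs F = 0 ->
  (h1 F + Ci * h2 F)%C = 0 -> F = Hscale (h1 F) HL.
Proof.
intros e0 es el.
assert (e2 : h2 F = (h1 F * Ci)%C).
{ replace (h2 F) with (h1 F * Ci - Ci * (h1 F + Ci * h2 F))%C
    by (ring [Ci_sqr]).
  rewrite el; Cring. }
assert (e3 : h3 F = 0).
{ assert (h : (h3 F * h3 F)%C = 0).
  { rewrite <- es; unfold Hs; rewrite e0, e2; ring [Ci_sqr]. }
  destruct (Cmult_eq_0 _ _ h); assumption. }
apply HC_eq; simpl.
- rewrite e0; Cring.
- Cring.
- rewrite e2; Cring.
- rewrite e3; Cring.
Qed.

(** Pole order zero: away from [p] itself [f] agrees with a function holomorphic near [p]. This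
    suffices for [chi], which has at most removable discontinuities. *)
Lemma meromorphic_at_eq (f g : C -> C) (p : C) :
  locally p (Cdifferentiable g) -> locally' p (fun z => f z = g z) ->
  meromorphic_at f p.
Proof.
intros hg hfg; exists O, g; split.
- revert hg; apply filter_imp; intros z; apply Cdifferentiable_iff.
- revert hfg; apply filter_imp; intros z ->; simpl.
  Cfield; intros e; apply RtoC_inj in e; lra.
Qed.

(** * Gluing the two choices of the conjugating function on an open set *)

Section Conjugation.
Variables (U : C -> Prop) (Phi : C -> HC).
Hypothesis hU : open U.
Hypothesis hPhi : Hholomorphic U Phi.
Hypothesis hnull : forall z, U z -> h0 (Phi z) = 0 /\ Hs (Phi z) = 0.

Lemma Hholomorphic_locally p : U p ->
  locally p (Cdifferentiable (fun z => h0 (Phi z))) /\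
  locally p (Cdifferentiable (fun z => h1 (Phi z))) /\
  locally p (Cdifferentiable (fun z => h2 (Phi z))) /\
  locally p (Cdifferentiable (fun z => h3 (Phi z))).
Proof.
intros hp; destruct hPhi as [H0 [H1 [H2 H3]]].
repeat split; generalize (hU p hp); apply filter_imp; intros z hz;
  apply Cdifferentiable_iff; auto.
Qed.

(** Half of [(Phi + L)^s], which decides whether the generic choice is invertible. *)
Definition ell (z : C) : C := (h1 (Phi z) + Ci * h2 (Phi z))%C.

Lemma ell_isolated p : U p ->
  locally p (fun z => ell z = 0) \/ locally' p (fun z => ell z <> 0).
Proof.
intros hp; apply isolated_zero.
destruct (Hholomorphic_locally p hp) as [_ [H1 [H2 _]]].
generalize (filter_and _ _ H1 H2); apply filter_imp; intros z [d1 d2].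
apply Cdifferentiable_plus; [exact d1|].
apply Cdifferentiable_mult; [apply Cdifferentiable_const|exact d2].
Qed.

(** The germ of [ell] at each point selects the formula, so that different components of the open
    set may use different ones. *)
Definition conjugator (z : C) : HC :=
  if excluded_middle_informative (locally z (fun y => ell y = 0))
  then chi_special (h1 (Phi z)) else chi_generic (Phi z).

Lemma conjugator_special p : locally p (fun z => ell z = 0) ->
  locally' p (fun z => conjugator z = chi_special (h1 (Phi z))).
Proof.
intros h; apply locally_locally, locally_punctured in h; revert h.
apply filter_imp; intros z hz; unfold conjugator.
destruct excluded_middle_informative as [_|n]; [reflexivity|contradiction].
Qed.

Lemma conjugator_generic p : locally' p (fun z => ell z <> 0) ->
  locally' p (fun z => conjugator z = chi_generic (Phi z)).
Proof.
apply filter_imp; intros z hz; unfold conjugator.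
destruct excluded_middle_informative as [l|_]; [|reflexivity].
exfalso; apply hz, (locally_singleton _ _ l).
Qed.

Lemma conjugator_meromorphic : Hmeromorphic U conjugator.
Proof.
assert (hk : forall (h : HC -> C) p, U p ->
  locally p (Cdifferentiable (fun z => h (chi_special (h1 (Phi z))))) ->
  locally p (Cdifferentiable (fun z => h (chi_generic (Phi z)))) ->
  meromorphic_at (fun z => h (conjugator z)) p).
{ intros h p hp hs hg; destruct (ell_isolated p hp) as [hl|hl].
  - apply conjugator_special in hl.
    apply (meromorphic_at_eq _ _ p hs); revert hl; apply filter_imp.
    intros z ->; reflexivity.
  - apply conjugator_generic in hl.
    apply (meromorphic_at_eq _ _ p hg); revert hl; apply filter_imp.
    intros z ->; reflexivity. }
assert (hc : forall c p, locally p (Cdifferentiable (fun _ => c))).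
{ intros c p; apply filter_forall; intros z; apply Cdifferentiable_const. }
assert (hadd : forall f c p, locally p (Cdifferentiable f) ->
  locally p (Cdifferentiable (fun z => f z + c)%C)).
{ intros f c p; apply filter_imp; intros z hz.
  apply Cdifferentiable_plus; [exact hz|apply Cdifferentiable_const]. }
repeat split; intros p hp; destruct (Hholomorphic_locally p hp) as [H0 [H1 [H2 H3]]];
  apply hk; simpl; auto.
generalize H1; apply filter_imp; intros z hz.
apply Cdifferentiable_mult; [apply Cdifferentiable_const|].
apply (Cdifferentiable_plus (fun z => h1 (Phi z)) (fun _ => (- RtoC 1)%C));
  [exact hz|apply Cdifferentiable_const].
Qed.

Lemma conjugator_conjugates :
  (forall p, U p -> ~ locally p (fun z => Phi z = HofC 0)) ->
  conjugates_L U Phi conjugator.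
Proof.
intros hnz p hp.
assert (hn : locally' p (fun z => h0 (Phi z) = 0 /\ Hs (Phi z) = 0)).
{ apply locally_punctured; generalize (hU p hp); apply filter_imp; auto. }
destruct (ell_isolated p hp) as [hl|hl].
(* If [h1 (Phi z)] vanished near [p] together with [ell], then [Phi], a multiple of [L] by that
   component, would vanish near [p]. *)
- assert (h1nz : locally' p (fun z => h1 (Phi z) <> 0)).
  { destruct (isolated_zero (fun z => h1 (Phi z)) p) as [h|h]; [|exfalso|exact h].
    - apply (Hholomorphic_locally p hp).
    - apply (hnz p hp).
      generalize (filter_and _ _ (hU p hp) (filter_and _ _ hl h)).
      apply filter_imp; intros z [hz [e1 e2]]; destruct (hnull z hz).
      rewrite (multiple_of_L (Phi z)), e2 by assumption.
      apply HC_eq; simpl; Cring. }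
  assert (hl' := locally_punctured _ _ hl).
  generalize (filter_and _ _ hn (filter_and _ _ hl' (filter_and _ _ h1nz
    (conjugator_special p hl)))).
  apply filter_imp; intros z [[e0 es] [hlz [h1z ->]]].
  assert (hsz : Hs (chi_special (h1 (Phi z))) <> 0).
  { rewrite Hs_chi_special; apply Cmult_neq_0; [|exact h1z].
    intros e; apply RtoC_inj in e; lra. }
  split; [exact hsz|].
  apply conjugation_by_invertible; [exact hsz|].
  rewrite chi_special_conj, <- multiple_of_L; auto.
- generalize (filter_and _ _ hn (filter_and _ _ hl (conjugator_generic p hl))).
  apply filter_imp; intros z [[e0 es] [hlz ->]].
  assert (hsz : Hs (chi_generic (Phi z)) <> 0).
  { rewrite Hs_chi_generic by assumption; apply Cmult_neq_0; [|exact hlz].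
    intros e; apply RtoC_inj in e; lra. }
  split; [exact hsz|].
  apply conjugation_by_invertible; [exact hsz|].
  apply chi_generic_conj; assumption.
Qed.

(** The identity theorem: the points where the germ of [Phi] is zero and those where it is not form
    two open sets covering a connected one. *)
Lemma nowhere_locally_zero :
  connected U -> (exists z, U z /\ Phi z <> HofC 0) ->
  forall p, U p -> ~ locally p (fun z => Phi z = HofC 0).
Proof.
intros hcon [q [hq hqn]] p hp hloc.
set (Z := fun z => U z /\ locally z (fun y => Phi y = HofC 0)).
set (N := fun z => U z /\ ~ locally z (fun y => Phi y = HofC 0)).
assert (hZ : open Z).
{ intros z [hz hl]; apply locally_locally in hl.
  generalize (filter_and _ _ (hU z hz) hl); apply filter_imp.
  intros y [h h']; split; assumption. }
(* A single component with an isolated zero, or none, at [z] keeps [Phi] nonzero around [z], hence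
   its germ nonzero at all nearby points. *)
assert (hcomp : forall (h : HC -> C) z, U z ->
  locally z (Cdifferentiable (fun y => h (Phi y))) -> h (HofC 0) = 0 ->
  locally z (fun y => h (Phi y) = 0) \/ locally z N).
{ intros h z hz hd he; destruct (isolated_zero _ z hd) as [hl|hl]; [left; exact hl|].
  destruct (excluded_middle_informative (locally z (fun y => Phi y = HofC 0)))
    as [hl'|hl'].
  - left; revert hl'; apply filter_imp; intros y ->; exact he.
  - right; generalize (filter_and _ _ (hU z hz) hl); apply filter_imp.
    intros y [hy hyn]; split; [exact hy|]; intros hly.
    destruct (Ceq_dec y z) as [->|n]; [contradiction|].
    apply (hyn n); rewrite (locally_singleton _ _ hly); exact he. }
assert (hN : open N).
{ intros z [hz hl]; destruct (Hholomorphic_locally z hz) as [H0 [H1 [H2 H3]]].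
  destruct (hcomp h0 z hz H0 eq_refl) as [l0|]; [|assumption].
  destruct (hcomp h1 z hz H1 eq_refl) as [l1|]; [|assumption].
  destruct (hcomp h2 z hz H2 eq_refl) as [l2|]; [|assumption].
  destruct (hcomp h3 z hz H3 eq_refl) as [l3|]; [|assumption].
  exfalso; apply hl.
  generalize (filter_and _ _ (filter_and _ _ l0 l1) (filter_and _ _ l2 l3)).
  apply filter_imp; intros y [[e0 e1] [e2 e3]]; apply HC_eq; assumption. }
destruct (hcon Z N hZ hN) as [z [_ [[_ h1] [_ h2]]]]; [| | |contradiction].
- intros z hz; destruct (excluded_middle_informative
    (locally z (fun y => Phi y = HofC 0))); [left|right]; split; assumption.
- exists p; repeat split; assumption.
- exists q; repeat split; try assumption.
  intros h; apply hqn, (locally_singleton _ _ h).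
Qed.

End Conjugation.

(** * Isothermal minimal surfaces *)

Lemma class_C_differentiable (U : C -> Prop) (f : C -> R) (p : C) :
  open U -> class_C 1 U f -> U p ->
  differentiable_pt_lim (fun u v => f (u, v)) (fst p) (snd p) (Du f p) (Dv f p).
Proof.
intros hU [_ [hex [[hcu _] _]]] hp.
apply filterdiff_differentiable_pt_lim.
apply (is_derive_filterdiff (fun u v => f (u, v)) (fst p) (snd p)
  (fun u v => Du f (u, v)) (Dv f p)).
- generalize (hU p hp); destruct p as [u0 v0]; apply filter_imp.
  intros [u v] h; apply (Derive_correct (fun u => f (u, v))), (hex (u, v) h).
- apply (Derive_correct (fun v => f (fst p, v))), (hex p hp).
- generalize (hcu p hp); destruct p as [u0 v0]; simpl.
  apply continuous_ext; intros [u v]; reflexivity.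
Qed.

Lemma class_C_expansion (U : C -> Prop) (f : C -> R) (p : C) :
  open U -> class_C 1 U f -> U p ->
  forall eps, 0 < eps -> exists d, 0 < d /\ forall z : C, Cmod (z - p) < d ->
    Rabs (f z - f p - (Du f p * (fst z - fst p) + Dv f p * (snd z - snd p)))
      <= eps * Cmod (z - p).
Proof.
intros hU hf hp eps he.
destruct (class_C_differentiable U f p hU hf hp (mkposreal eps he)) as [d hd].
exists d; split; [apply cond_pos|]; intros z hz.
assert (hm := Rmax_Cmod (z - p)%C).
change (fst (z - p)%C) with (fst z - fst p) in hm.
change (snd (z - p)%C) with (snd z - snd p) in hm.
pose proof (Rmax_l (Rabs (fst z - fst p)) (Rabs (snd z - snd p))).
pose proof (Rmax_r (Rabs (fst z - fst p)) (Rabs (snd z - snd p))).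
specialize (hd (fst z) (snd z) ltac:(lra) ltac:(lra)); simpl in hd.
rewrite <- !surjective_pairing in hd.
eapply Rle_trans; [exact hd|]; apply Rmult_le_compat_l; lra.
Qed.

Lemma Cauchy_Riemann (U : C -> Prop) (a b : C -> R) (p : C) :
  open U -> class_C 1 U a -> class_C 1 U b -> U p ->
  Du a p = Dv b p -> Dv a p = - Du b p ->
  @ex_derive C_AbsRing C_NormedModule (fun z => (a z, b z)) p.
Proof.
intros hU ha hb hp e1 e2; apply ex_derive_Cmod; exists (Du a p, Du b p).
intros eps he.
destruct (class_C_expansion U a p hU ha hp (eps / 2) ltac:(lra)) as [d1 [hd1 H1]].
destruct (class_C_expansion U b p hU hb hp (eps / 2) ltac:(lra)) as [d2 [hd2 H2]].
exists (Rmin d1 d2); split; [apply Rmin_glb_lt; assumption|].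
intros y hy.
specialize (H1 y (Rlt_le_trans _ _ _ hy (Rmin_l _ _))).
specialize (H2 y (Rlt_le_trans _ _ _ hy (Rmin_r _ _))).
eapply Rle_trans; [apply Cmod_2Rmax|].
set (N := Cmod (y - p)%C) in *.
assert (hN : 0 <= N) by apply Cmod_ge_0.
assert (h2 : sqrt 2 <= 2).
{ rewrite <- (sqrt_square 2) at 2 by lra; apply sqrt_le_1; lra. }
assert (h2' : 0 <= sqrt 2) by apply sqrt_pos.
apply Rle_trans with (sqrt 2 * (eps / 2 * N)).
- apply Rmult_le_compat_l; [assumption|]; apply Rmax_lub.
  + eapply Rle_trans; [|exact H1]; right; f_equal; simpl; rewrite e2; ring.
  + eapply Rle_trans; [|exact H2]; right; f_equal; simpl; rewrite <- e1; ring.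
- assert (0 <= eps / 2 * N) by (apply Rmult_le_pos; lra). nra.
Qed.

Lemma Schwarz_class_C (U : C -> Prop) (f : C -> R) (p : C) :
  open U -> class_C 2 U f -> U p -> Du (Dv f) p = Dv (Du f) p.
Proof.
intros hU [_ [hex [hu hv]]] hp.
destruct hu as [_ [hexu [_ [hcuv _]]]], hv as [_ [hexv [[hcvu _] _]]].
destruct p as [x y].
apply (Schwarz (fun u v => f (u, v)) x y).
- apply locally_2d_locally; generalize (hU (x, y) hp); apply filter_imp.
  intros [u v] h; destruct (hex _ h), (hexu _ h), (hexv _ h).
  repeat split; assumption.
- apply continuity_2d_pt_filterlim; exact (hcvu (x, y) hp).
- apply continuity_2d_pt_filterlim; exact (hcuv (x, y) hp).
Qed.

Lemma Du_Dv_ext_loc (f g : C -> R) (p : C) :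
  locally p (fun z => f z = g z) -> Du f p = Du g p /\ Dv f p = Dv g p.
Proof.
intros [d h]; split; apply Derive_ext_loc; exists d; intros t ht; apply h;
  (split; [|]); simpl; try exact ht; apply ball_center.
Qed.

(** * Vector calculus in space *)

Definition coordinate (x : R3 -> R) : Prop := x = x1 \/ x = x2 \/ x = x3.

Lemma Derive_dot3 (a1 a2 a3 b1 b2 b3 : R -> R) (t : R) :
  ex_derive a1 t -> ex_derive a2 t -> ex_derive a3 t ->
  ex_derive b1 t -> ex_derive b2 t -> ex_derive b3 t ->
  Derive (fun t => a1 t * b1 t + a2 t * b2 t + a3 t * b3 t) t =
  (Derive a1 t * b1 t + Derive a2 t * b2 t + Derive a3 t * b3 t) +
  (a1 t * Derive b1 t + a2 t * Derive b2 t + a3 t * Derive b3 t).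
Proof.
intros; apply is_derive_unique; auto_derive; [repeat split; assumption|].
change (fun x : R => a1 x) with a1; change (fun x : R => a2 x) with a2;
change (fun x : R => a3 x) with a3; change (fun x : R => b1 x) with b1;
change (fun x : R => b2 x) with b2; change (fun x : R => b3 x) with b3; ring.
Qed.

Lemma Du_dot (A B : C -> R3) (p : C) :
  (forall x, coordinate x ->
    ex_derive (fun u => x (A (u, snd p))) (fst p) /\
    ex_derive (fun u => x (B (u, snd p))) (fst p)) ->
  Du (fun q => dot (A q) (B q)) p = dot (D3u A p) (B p) + dot (A p) (D3u B p).
Proof.
intros h; destruct (h x1) as [a1 b1]; [unfold coordinate; auto|].
destruct (h x2) as [a2 b2]; [unfold coordinate; auto|].
destruct (h x3) as [a3 b3]; [unfold coordinate; auto|].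
assert (e := Derive_dot3
  (fun u => x1 (A (u, snd p))) (fun u => x2 (A (u, snd p))) (fun u => x3 (A (u, snd p)))
  (fun u => x1 (B (u, snd p))) (fun u => x2 (B (u, snd p))) (fun u => x3 (B (u, snd p)))
  (fst p) a1 a2 a3 b1 b2 b3); cbv beta in e.
rewrite <- surjective_pairing in e.
etransitivity; [exact e|].
unfold dot, D3u, Du, x1, x2, x3; simpl; ring.
Qed.

Lemma Dv_dot (A B : C -> R3) (p : C) :
  (forall x, coordinate x ->
    ex_derive (fun v => x (A (fst p, v))) (snd p) /\
    ex_derive (fun v => x (B (fst p, v))) (snd p)) ->
  Dv (fun q => dot (A q) (B q)) p = dot (D3v A p) (B p) + dot (A p) (D3v B p).
Proof.
intros h; destruct (h x1) as [a1 b1]; [unfold coordinate; auto|].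
destruct (h x2) as [a2 b2]; [unfold coordinate; auto|].
destruct (h x3) as [a3 b3]; [unfold coordinate; auto|].
assert (e := Derive_dot3
  (fun v => x1 (A (fst p, v))) (fun v => x2 (A (fst p, v))) (fun v => x3 (A (fst p, v)))
  (fun v => x1 (B (fst p, v))) (fun v => x2 (B (fst p, v))) (fun v => x3 (B (fst p, v)))
  (snd p) a1 a2 a3 b1 b2 b3); cbv beta in e.
rewrite <- surjective_pairing in e.
etransitivity; [exact e|].
unfold dot, D3v, Dv, x1, x2, x3; simpl; ring.
Qed.

Lemma R3_eq (a b : R3) : x1 a = x1 b -> x2 a = x2 b -> x3 a = x3 b -> a = b.
Proof.
destruct a as [[a1 a2] a3], b as [[b1 b2] b3]; unfold x1, x2, x3; simpl.
intros; subst; reflexivity.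
Qed.

Lemma dot_add3_l a b c : dot (add3 a b) c = dot a c + dot b c.
Proof. unfold dot, add3, x1, x2, x3; simpl; ring. Qed.

Lemma dot_comm a b : dot a b = dot b a.
Proof. unfold dot; ring. Qed.

Lemma dot_cross_cross P Q :
  dot (cross P Q) (cross P Q) = dot P P * dot Q Q - dot P Q * dot P Q.
Proof. unfold dot, cross, x1, x2, x3; simpl; ring. Qed.

(* [V x (P x Q) = (V.Q) P - (V.P) Q], so a vector orthogonal to [P], [Q] and
   [P x Q] is both parallel and orthogonal to [P x Q]. *)
Lemma orthogonal_to_frame (V P Q : R3) :
  dot V P = 0 -> dot V Q = 0 -> dot V (cross P Q) = 0 ->
  0 < dot (cross P Q) (cross P Q) -> V = (0, 0, 0).
Proof.
intros hP hQ hn hpos; set (n := cross P Q) in *.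
assert (hc : cross V n = (0, 0, 0)).
{ transitivity (add3 (scale3 (dot V Q) P) (scale3 (- dot V P) Q)).
  - apply R3_eq; unfold n, cross, add3, scale3, dot, x1, x2, x3; simpl; ring.
  - rewrite hP, hQ; apply R3_eq; unfold add3, scale3, x1, x2, x3; simpl; ring. }
assert (e : scale3 (dot n n) V = add3 (scale3 (dot V n) n) (cross n (cross V n))).
{ clearbody n; apply R3_eq; unfold cross, add3, scale3, dot, x1, x2, x3; simpl; ring. }
rewrite hn, hc in e.
apply R3_eq; apply (Rmult_eq_reg_l (dot n n)); try lra; clearbody n.
- apply (f_equal x1) in e; revert e.
  unfold scale3, add3, cross, x1, x2, x3; simpl; lra.
- apply (f_equal x2) in e; revert e.
  unfold scale3, add3, cross, x1, x2, x3; simpl; lra.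
- apply (f_equal x3) in e; revert e.
  unfold scale3, add3, cross, x1, x2, x3; simpl; lra.
Qed.

(** * Harmonicity of the coordinates and holomorphy of the complex gradient *)

Section Surface.
Variables (U : C -> Prop) (X : C -> R3).
Hypothesis hU : open U.
Hypothesis hX : smooth U X.
Hypothesis hiso : isothermal U X.
Hypothesis hmin : minimal U X.

Lemma smooth_coordinate n x : coordinate x ->
  class_C n U (fun q => x (X q)).
Proof.
destruct (hX n) as [c1 [c2 c3]]; intros [->|[->| ->]]; assumption.
Qed.

Lemma ex_derive_D3 p x : U p -> coordinate x ->
  (ex_derive (fun u => x (D3u X (u, snd p))) (fst p) /\
   ex_derive (fun u => x (D3v X (u, snd p))) (fst p)) /\
  (ex_derive (fun v => x (D3u X (fst p, v))) (snd p) /\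
   ex_derive (fun v => x (D3v X (fst p, v))) (snd p)).
Proof.
intros hp hx.
destruct (smooth_coordinate 2 x hx) as [_ [_ [[_ [hu _]] [_ [hv _]]]]].
destruct (hu p hp) as [uu vu], (hv p hp) as [uv vv].
destruct hx as [->|[->| ->]]; repeat split; assumption.
Qed.

Lemma Laplacian_0 p : U p -> add3 (D3u (D3u X) p) (D3v (D3v X) p) = (0, 0, 0).
Proof.
intros hp.
assert (hM : D3v (D3u X) p = D3u (D3v X) p).
{ assert (h : forall x, coordinate x ->
    Dv (Du (fun q => x (X q))) p = Du (Dv (fun q => x (X q))) p).
  { intros x hx; symmetry.
    apply (Schwarz_class_C U); auto; apply smooth_coordinate, hx. }
  unfold D3v at 1, D3u at 4.
  f_equal; [f_equal|].
  - apply (h x1); unfold coordinate; auto.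
  - apply (h x2); unfold coordinate; auto.
  - apply (h x3); unfold coordinate; auto. }
assert (hloc : forall f g : C -> R, (forall q, U q -> f q = g q) ->
  Du f p = Du g p /\ Dv f p = Dv g p).
{ intros f g h; apply Du_Dv_ext_loc; generalize (hU p hp); apply filter_imp; exact h. }
destruct (hloc (fun q => dot (D3u X q) (D3u X q)) (fun q => dot (D3v X q) (D3v X q)))
  as [eu ev]; [intros q hq; apply (hiso q hq)|].
destruct (hloc (fun q => dot (D3u X q) (D3v X q)) (fun _ => 0)) as [fu fv];
  [intros q hq; apply (hiso q hq)|].
replace (Du (fun _ => 0) p) with 0 in fu by (symmetry; exact (Derive_const 0 _)).
replace (Dv (fun _ => 0) p) with 0 in fv by (symmetry; exact (Derive_const 0 _)).
rewrite (Du_dot (D3u X) (D3u X)), (Du_dot (D3v X) (D3v X)) in eu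
  by (intros x hx; split; apply (ex_derive_D3 p x hp hx)).
rewrite Du_dot in fu by (intros x hx; split; apply (ex_derive_D3 p x hp hx)).
rewrite (Dv_dot (D3u X) (D3u X)), (Dv_dot (D3v X) (D3v X)) in ev
  by (intros x hx; split; apply (ex_derive_D3 p x hp hx)).
rewrite Dv_dot in fv by (intros x hx; split; apply (ex_derive_D3 p x hp hx)).
rewrite hM in ev, fv.
destruct (hiso p hp) as [hE [hpos hF]].
assert (hm := hmin p hp); unfold mean_curvature, unit_normal in hm.
set (P := D3u X p) in *; set (Q := D3v X p) in *.
set (M := D3u (D3v X) p) in *.
set (Puu := D3u (D3u X) p) in *; set (Qvv := D3v (D3v X) p) in *.
assert (hnn : dot (cross P Q) (cross P Q) = dot P P * dot P P).
{ rewrite dot_cross_cross, hF, <- hE; ring. }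
rewrite <- hE, hF in hm.
pose proof (dot_comm P M); pose proof (dot_comm Q M).
pose proof (dot_comm P Puu); pose proof (dot_comm Q Puu).
pose proof (dot_comm P Qvv); pose proof (dot_comm Q Qvv).
(* By [eu] and [fv], the products of [X_uu] and [X_vv] with [X_u] are [<X_uv, X_v>] and its
   opposite; by [fu] and [ev], those with [X_v] are [- <X_uv, X_u>] and its opposite. *)
apply (orthogonal_to_frame _ P Q); rewrite ?dot_add3_l.
- lra.
- lra.
- set (n := cross P Q) in *.
  assert (hs : forall V c, dot V (scale3 c n) = c * dot V n)
    by (intros V c; unfold dot, scale3, x1, x2, x3; simpl; ring).
  rewrite !hs in hm.
  assert (hn0 : 0 < norm3 n).
  { unfold norm3; apply sqrt_lt_R0; rewrite hnn; nra. }
  (* With [F = 0] and [G = E] the mean curvature is [(e + g) / (2 E)]; multiplying by [2 E |n|]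
     recovers the product of the Laplacian with the unnormalised normal. *)
  assert (hm' : dot Puu n + dot Qvv n = (/ norm3 n * dot Puu n * dot P P
    - 2 * (/ norm3 n * dot (D3v (D3u X) p) n) * 0 + / norm3 n * dot Qvv n * dot P P)
    / (2 * (dot P P * dot P P - 0 * 0)) * (2 * dot P P * norm3 n))
    by (field; lra).
  rewrite hm', hm; ring.
- rewrite hnn; nra.
Qed.

(** Twice the Wirtinger derivative of [f] in [z]; the real part of its product with
    [du + sqrt(-1) dv] is the differential of [f]. *)
Definition complex_gradient (f : C -> R) (z : C) : C := (Du f z, - Dv f z).

Definition Phi_of_surface (z : C) : HC :=
  mkHC 0 (complex_gradient (fun q => x1 (X q)) z) (complex_gradient (fun q => x2 (X q)) z)
    (complex_gradient (fun q => x3 (X q)) z).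

Lemma class_C_opp n f : class_C n U f -> class_C n U (fun q => - f q).
Proof.
revert f; induction n as [|n IH]; intros f.
- intros [hc _]; split; [|exact I]; intros p hp; apply continuous_Ropp, hc, hp.
- intros [hc [hex [hu hv]]]; split; [|split; [|split]].
  + intros p hp; apply continuous_Ropp, hc, hp.
  + intros p hp; destruct (hex p hp) as [e1 e2]; split.
    * apply (ex_derive_opp (V := R_NormedModule)), e1.
    * apply (ex_derive_opp (V := R_NormedModule)), e2.
  (* [class_C] is a predicate on functions, so the pointwise equality has to become an equality of
     functions before the induction hypothesis applies. *)
  + assert (e : forall p, - Du f p = Du (fun q => - f q) p)
      by (intros p; symmetry; apply Derive_opp).
    apply FunctionalExtensionality.functional_extensionality in e.
    rewrite <- e; apply IH, hu.
  + assert (e : forall p, - Dv f p = Dv (fun q => - f q) p)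
      by (intros p; symmetry; apply Derive_opp).
    apply FunctionalExtensionality.functional_extensionality in e.
    rewrite <- e; apply IH, hv.
Qed.

(** Of the Cauchy-Riemann equations for [(f_u, - f_v)], one is harmonicity and the other the
    symmetry of second derivatives. *)
Lemma complex_gradient_holomorphic (f : C -> R) :
  class_C 2 U f -> (forall p, U p -> Du (Du f) p + Dv (Dv f) p = 0) ->
  holomorphic U (complex_gradient f).
Proof.
intros hf hlap p hp.
assert (hs := Schwarz_class_C U f p hU hf hp); specialize (hlap p hp).
destruct hf as [_ [_ [hu hv]]].
apply (Cauchy_Riemann U (Du f) (fun q => - Dv f q)); auto using class_C_opp.
- unfold Dv at 1; rewrite Derive_opp; fold (Dv (Dv f) p).
  change (Derive (fun v => Dv f (fst p, v)) (snd p)) with (Dv (Dv f) p); lra.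
- unfold Du at 2; rewrite Derive_opp.
  change (Derive (fun u => Dv f (u, snd p)) (fst p)) with (Du (Dv f) p); lra.
Qed.

Lemma Phi_of_surface_holomorphic : Hholomorphic U Phi_of_surface.
Proof.
assert (hlap : forall x, coordinate x ->
  holomorphic U (complex_gradient (fun q => x (X q)))).
{ intros x hx; apply complex_gradient_holomorphic; [apply smooth_coordinate, hx|].
  intros p hp; assert (h := Laplacian_0 p hp).
  apply (f_equal x) in h; destruct hx as [->|[->| ->]]; exact h. }
repeat split; simpl.
- intros p _; apply Cdifferentiable_iff, Cdifferentiable_const.
- apply (hlap x1); unfold coordinate; auto.
- apply (hlap x2); unfold coordinate; auto.
- apply (hlap x3); unfold coordinate; auto.
Qed.

(** [Phi^s = (E - G) - 2 sqrt(-1) F] in terms of the first fundamental form, and isothermal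
    coordinates make both parts zero. *)
Lemma Phi_of_surface_null z : U z ->
  h0 (Phi_of_surface z) = 0 /\ Hs (Phi_of_surface z) = 0.
Proof.
intros hz; split; [reflexivity|].
destruct (hiso z hz) as [hE [_ hF]]; unfold dot, D3u, D3v, x1, x2, x3 in hE, hF.
simpl in hE, hF.
unfold Hs, Phi_of_surface, complex_gradient, x1, x2, x3; simpl.
apply injective_projections; simpl; lra.
Qed.

(** A zero of [Phi] would annihilate [X_u], against [E > 0]; this provides non-vanishing on every
    component of [U]. *)
Lemma Phi_of_surface_neq_0 z : U z -> Phi_of_surface z <> HofC 0.
Proof.
intros hz e; destruct (hiso z hz) as [_ [hpos _]].
injection e; intros; unfold dot, D3u, x1, x2, x3 in *; simpl in *.
repeat match goal with h : Du _ z = 0 |- _ => rewrite h in hpos; clear h end.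
lra.
Qed.

(** * Recovering a function from its complex gradient along curves *)

Section Path.
Variable f : C -> R.
Hypothesis hf : class_C 1 U f.
Hypothesis hhol : holomorphic U (complex_gradient f).

(** By the chain rule the real part of the integrand is the derivative of [f (h t)]. The integral is
    quantified existentially because only its real part is evaluated. *)
Lemma path_integral_C1 (h : R -> C) (a b : R) :
  a <= b -> C1_path h -> (forall t, a <= t <= b -> U (h t)) ->
  exists I : C, is_CRInt (fun t => complex_gradient f (h t) * path_derive h t)%C a b I /\
    fst I = f (h b) - f (h a).
Proof.
intros hab hh hin.
set (w := fun t => (complex_gradient f (h t) * path_derive h t)%C).
assert (hw : forall t, a <= t <= b -> continuous w t).
{ intros t ht; destruct (hh t) as [d1 [d2 hc]].
  apply continuous_Cmult; [|exact hc].
  apply (continuous_comp h (complex_gradient f)).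
  - apply continuous_pair;
      [apply (ex_derive_continuous (V := R_NormedModule)), d1
      |apply (ex_derive_continuous (V := R_NormedModule)), d2].
  - apply Cdifferentiable_continuous, Cdifferentiable_iff, hhol, hin, ht. }
assert (hi := CRInt_correct w a b hab hw).
exists (CRInt w a b); split; [exact hi|].
apply (is_RInt_fct_extend_fst (U := R_NormedModule) (V := R_NormedModule)) in hi.
etransitivity; [symmetry; exact (is_RInt_unique _ _ _ _ hi)|].
apply is_RInt_unique.
apply (is_RInt_derive (fun t => f (h t)));
  rewrite Rmin_left, Rmax_right by exact hab.
- intros t ht; destruct (hh t) as [d1 [d2 _]].
  assert (hd := class_C_differentiable U f (h t) hU hf (hin t ht)).
  assert (e : is_derive (fun t => f (fst (h t), snd (h t))) t
    (Du f (h t) * Derive (fun s => fst (h s)) t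
     + Dv f (h t) * Derive (fun s => snd (h s)) t)).
  { apply is_derive_Reals.
    apply (derivable_pt_lim_comp_2d (fun u v => f (u, v)) (fun t => fst (h t))
      (fun t => snd (h t))); [exact hd| |]; apply is_derive_Reals, Derive_correct;
      assumption. }
  apply (is_derive_ext (fun t => f (fst (h t), snd (h t))));
    [intros s; rewrite <- surjective_pairing; reflexivity|].
  assert (ew : Du f (h t) * Derive (fun s => fst (h s)) t
    + Dv f (h t) * Derive (fun s => snd (h s)) t = fst (w t))
    by (unfold w, complex_gradient, path_derive; simpl; ring).
  rewrite ew in e; exact e.
- intros t ht; apply continuous_Re, hw, ht.
Qed.

(** The increments of [f] over the successive pieces telescope. *)
Lemma path_integral_piecewise_C1 (gamma : R -> C) :
  piecewise_C1 gamma -> (forall t, 0 <= t <= 1 -> U (gamma t)) ->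
  Re (path_integral (complex_gradient f) gamma) = f (gamma 1) - f (gamma 0).
Proof.
intros [N [s [s0 [sN hs]]]] hin.
set (w := fun t => (complex_gradient f (gamma t) * path_derive gamma t)%C).
assert (mono : forall j k, (j + k <= N)%nat -> s j <= s (j + k)%nat).
{ intros j k; induction k as [|k IH]; intros hk; [rewrite Nat.add_0_r; lra|].
  rewrite Nat.add_succ_r; destruct (hs (j + k)%nat) as [h _]; [lia|].
  specialize (IH ltac:(lia)); lra. }
assert (hI : forall k, (k <= N)%nat -> exists I : C,
  is_CRInt w 0 (s k) I /\ fst I = f (gamma (s k)) - f (gamma 0)).
{ intros k; induction k as [|k IH]; intros hk.
  - exists (RtoC 0); rewrite s0; split; [|simpl; ring].
    apply (is_RInt_point (V := C_R_NormedModule)).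
  - destruct (IH ltac:(lia)) as [I [hI1 hI2]].
    destruct (hs k ltac:(lia)) as [hlt [h [hh heq]]].
    assert (hk0 : 0 <= s k) by (rewrite <- s0; apply (mono O k); lia).
    assert (hk1 : s (S k) <= 1).
    { pose proof (mono (S k) (N - S k)%nat ltac:(lia)) as hm.
      replace (S k + (N - S k))%nat with N in hm by lia; lra. }
    destruct (path_integral_C1 h (s k) (s (S k))) as [J [hJ1 hJ2]].
    + lra.
    + exact hh.
    + intros t ht; rewrite <- heq by exact ht; apply hin; lra.
    + exists (I + J)%C; split.
      * apply (is_RInt_Chasles (V := C_R_NormedModule) w 0 (s k)); [exact hI1|].
        revert hJ1; apply (is_RInt_ext (V := C_R_NormedModule)).
        rewrite Rmin_left, Rmax_right by lra; intros t ht; unfold w.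
        rewrite (heq t) by lra; f_equal.
        (* Inside a piece [gamma] coincides with [h] on a neighbourhood, so the derivatives agree;
           the break points, where [path_derive gamma] may be a default value, do not affect the
           integral. *)
        assert (hloc : locally t (fun y => h y = gamma y)).
        { assert (hd : 0 < Rmin (t - s k) (s (S k) - t)) by (apply Rmin_glb_lt; lra).
          exists (mkposreal _ hd); intros y hy.
          pose proof (Rmin_l (t - s k) (s (S k) - t)).
          pose proof (Rmin_r (t - s k) (s (S k) - t)).
          apply Rabs_lt_between' in hy; simpl in hy; symmetry; apply heq; lra. }
        unfold path_derive; f_equal; apply Derive_ext_loc; revert hloc;
          apply filter_imp; intros y ->; reflexivity.
      * simpl; rewrite hI2, hJ2, <- !heq by lra; ring. }
destruct (hI N (le_n N)) as [I [hI1 hI2]].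
rewrite sN in hI1, hI2; rewrite <- hI2.
unfold path_integral, Re; f_equal; exact (is_CRInt_unique _ _ _ _ hI1).
Qed.

End Path.

Lemma surface_representation z0 z gamma D :
  subset D U -> simple_curve_in D z0 z gamma ->
  X z = add3 (X z0) (Re_path_integral Phi_of_surface gamma).
Proof.
intros hDU [hpc [_ [hin [e0 e1]]]].
destruct Phi_of_surface_holomorphic as [_ [H1 [H2 H3]]].
assert (hin' : forall t, 0 <= t <= 1 -> U (gamma t)) by (intros t ht; apply hDU, hin, ht).
assert (hx : forall x, coordinate x -> holomorphic U (complex_gradient (fun q => x (X q))) ->
  x (X z) = x (X z0) + Re (path_integral (complex_gradient (fun q => x (X q))) gamma)).
{ intros x hx hh; rewrite (path_integral_piecewise_C1 (fun q => x (X q)));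
    auto using smooth_coordinate.
  rewrite e0, e1; ring. }
apply R3_eq.
- apply (hx x1); [unfold coordinate; auto|exact H1].
- apply (hx x2); [unfold coordinate; auto|exact H2].
- apply (hx x3); [unfold coordinate; auto|exact H3].
Qed.

End Surface.

Theorem corollary4p1 :
  (forall (Omega : C -> Prop) (Phi : C -> HC),
      planar_domain Omega ->
      Hholomorphic Omega Phi ->
      (forall z : C, Omega z -> h0 (Phi z) = 0 /\ Hs (Phi z) = 0) ->
      (exists z : C, Omega z /\ Phi z <> HofC 0) ->
      exists chi : C -> HC,
        Hmeromorphic Omega chi /\ conjugates_L Omega Phi chi)
  /\
  (forall (U : C -> Prop) (X : C -> R3),
      open U ->
      smooth U X ->
      isothermal U X ->
      minimal U X ->
      exists (Phi chi : C -> HC),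
        Hholomorphic U Phi /\
        (forall z : C, U z -> h0 (Phi z) = 0 /\ Hs (Phi z) = 0) /\
        Hmeromorphic U chi /\
        conjugates_L U Phi chi /\
        forall z0 : C, U z0 ->
          exists c : R3,
            forall D : C -> Prop,
              simply_connected_domain D -> subset D U -> D z0 ->
              forall (z : C) (gamma : R -> C),
                simple_curve_in D z0 z gamma ->
                X z = add3 c (Re_path_integral Phi gamma)).
Proof.
split.
- intros Omega Phi [hO [hcon _]] hhol hnull hex.
  exists (conjugator Phi); split.
  + apply conjugator_meromorphic; assumption.
  + apply conjugator_conjugates; try assumption.
    apply nowhere_locally_zero; assumption.
- intros U X hU hX hiso hmin.
  assert (hhol := Phi_of_surface_holomorphic U X hU hX hiso hmin).
  assert (hnull := Phi_of_surface_null U X hiso).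
  exists (Phi_of_surface X), (conjugator (Phi_of_surface X)).
  split; [exact hhol|]; split; [exact hnull|].
  split; [apply conjugator_meromorphic; assumption|].
  split.
  + apply conjugator_conjugates; try assumption.
    intros p hp hl; apply (Phi_of_surface_neq_0 U X hiso p hp).
    exact (locally_singleton _ _ hl).
  + intros z0 hz0; exists (X z0); intros D _ hDU _ z gamma hgamma.
    apply (surface_representation U X hU hX hiso hmin z0 z gamma D); assumption.
Qed.
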